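(* Let $K\ge 2$, let $\Delta_{K-1}=\{\theta\in\mathbb{R}^K:\theta_i\ge 0,\ \sum_{i=1}^K\theta_i=1\}$, and let $\alpha\in(0,\infty)^K$. Let $H:\mathbb{R}^K\to\mathbb{R}$ satisfy conditions (A1)–(A4) below at the point $\theta^*\in\Delta_{K-1}$, let $Z=\{i:\theta^*_i=0\}$ and $m=|Z|$. Then, as $n\to\infty$, $$\mathbb{E}_{\theta\sim \mathrm{Dir}_\alpha}\big[e^{nH(\theta)}\big]\sim C_H\, e^{nH(\theta^* )}\, n^{-\frac{K-1-m}{2}}\, n^{-\sum_{i\in Z}\alpha_i}$$ for some constant $C_H\in(0,\infty)$ (independent of $n$).
   Context: $\mathrm{Dir}_\alpha$ is the Dirichlet distribution on $\Delta_{K-1}$: $(\theta_1,\dots,\theta_{K-1})$ has Lebesgue density $\frac{1}{B(\alpha)}\prod_{i=1}^{K}\theta_i^{\alpha_i-1}$ with $\theta_K=1-\sum_{i<K}\theta_i$, where $B(\alpha)=\prod_i\Gamma(\alpha_i)/\Gamma(\sum_i\alpha_i)$. Conditions: (A1) $H$ attains its maximum over $\Delta_{K-1}$ only at $\theta^*$. (A2) $H$ is continuous on $\Delta_{K-1}$ and twice continuously differentiable on an open neighborhood of $\theta^*$ in $\mathbb{R}^K$. With $Z=\{i:\theta^*_i=0\}$, there are (unique) KKT multipliers $\lambda_i\ge 0$ ($i\in Z$) and $\mu\in\mathbb{R}$ with $\nabla H(\theta^* )=-\sum_{i\in Z}\lambda_i e_i+\mu\mathbf{1}_K$, where $e_i$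 are standard basis vectors and $\mathbf{1}_K$ the all-ones vector. (A3) $\lambda_i>0$ for all $i\in Z$. (A4) $d^\top\nabla^2H(\theta^* )d<0$ for every nonzero $d\in\mathbb{R}^K$ with $\mathbf{1}_K^\top d=0$ and $d_i=0$ for all $i\in Z$. The parameter $n$ ranges over positive reals, and $f(n)\sim g(n)$ means $f(n)/g(n)\to1$. *)

(* Defs.v *)
From HB Require Import structures.
From mathcomp Require Import all_boot all_order all_algebra.
From mathcomp Require Import all_classical all_reals all_analysis.

Set Implicit Arguments.
Unset Strict Implicit.
Unset Printing Implicit Defensive.

Import Order.TTheory GRing.Theory Num.Theory.
Import numFieldNormedType.Exports.

Local Open Scope classical_set_scope.
Local Open Scope ring_scope.

Section Defs.
Variable R : realType.

(* Lebesgue integral of an (extended-real valued) function on R^n, written as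
   the iterated one-dimensional Lebesgue integral (Tonelli); points of R^n are
   n-tuples. *)
Fixpoint leb_int (n : nat) : (n.-tuple R -> \bar R) -> \bar R :=
  match n with
  | 0 => fun f => f [tuple]
  | n'.+1 => fun f =>
      (\int[@lebesgue_measure R]_x leb_int (fun t : n'.-tuple R => f [tuple of x :: t]))%E
  end.

Definition basis_vec (K : nat) (i : 'I_K) : 'rV[R]_K := delta_mx 0 i.

Definition simplex (K : nat) : set 'rV[R]_K :=
  [set th | (forall i, 0 <= th 0 i) /\ \sum_(i < K) th 0 i = 1].

Definition complete_pt (K : nat) (t : K.-1.-tuple R) : 'rV[R]_K :=
  \row_(i < K) (if (i < K.-1)%N then nth 0 t i else 1 - \sum_(j <- t) j).

Definition dir_kernel (K : nat) (alpha : 'I_K -> R) (t : K.-1.-tuple R) : R :=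
  if `[< simplex (complete_pt t) >] then
    \prod_(i < K) (complete_pt t 0 i) `^ (alpha i - 1)
  else 0.

(* B(alpha) = integral of the unnormalised density (= prod Gamma / Gamma(sum)) *)
Definition dir_norm (K : nat) (alpha : 'I_K -> R) : \bar R :=
  leb_int (fun t => (dir_kernel alpha t)%:E).

Definition dir_expect (K : nat) (alpha : 'I_K -> R) (f : 'rV[R]_K -> R) : \bar R :=
  (leb_int (fun t => (dir_kernel alpha t * f (complete_pt t))%:E)
   * (fine (dir_norm alpha))^-1%:E)%E.

Definition partial (K : nat) (i : 'I_K) (f : 'rV[R]_K -> R) : 'rV[R]_K -> R :=
  fun x => 'D_(basis_vec i) f x.

Definition gradient (K : nat) (f : 'rV[R]_K -> R) (x : 'rV[R]_K) : 'rV[R]_K :=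
  \row_(i < K) partial i f x.

Definition hessian (K : nat) (f : 'rV[R]_K -> R) (x : 'rV[R]_K) : 'M[R]_K :=
  \matrix_(i < K, j < K) partial j (partial i f) x.

Definition C2_on (K : nat) (U : set 'rV[R]_K) (f : 'rV[R]_K -> R) : Prop :=
  [/\ open U,
      (forall i x, U x -> derivable f x (basis_vec i)),
      (forall i j x, U x -> derivable (partial i f) x (basis_vec j)) &
      (forall i j, {within U, continuous (partial j (partial i f))})].

Definition zero_idx (K : nat) (ths : 'rV[R]_K) : {set 'I_K} :=
  [set i : 'I_K | ths 0 i == 0]%SET.

End Defs.

Arguments basis_vec {R K}.
Arguments simplex {R K}.

(* Main.v *)
(** Laplace's method. Put s = n^(-1/2), let Z be the active set and let k be an
index outside Z. In the chart of the simplex that omits the coordinate k, write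
theta_i = s^2 x_i for i in Z and theta_i = ths_i + s x_i otherwise. The
change of variables and the factors theta_i^(alpha_i - 1), i in Z, contribute
exactly n^(-(K-1-m)/2 - sum_Z alpha_i), and by the KKT conditions
n (H(theta) - H(ths)) converges to
- sum_Z lambda_i x_i + y^T (hess H) y / 2, where y is the tangential part of x.

Dominated convergence rests on one inequality valid on the whole simplex:
  H(theta) - H(ths) <= - c (sum_Z theta_i + sum_i (theta_i - ths_i)^2).
Near ths it follows from a second-order expansion and Finsler's lemma, and
elsewhere from compactness. It bounds the rescaled integrand by a product of
one-dimensional Gamma and Gaussian densities, so the iterated integral can be
treated one variable at a time. The points with theta_i < ths_i / 2 for some
i outside Z, where theta_i^(alpha_i - 1) may be unbounded, have an exponentially
small contribution. *)

Require Import Defs.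
From HB Require Import structures.
From mathcomp Require Import all_boot all_order all_algebra.
From mathcomp Require Import all_classical all_reals all_analysis.
From mathcomp Require Import measurable_realfun perm ring lra.
Import Order.TTheory GRing.Theory Num.Theory.
Import numFieldNormedType.Exports.
Local Open Scope classical_set_scope.
Local Open Scope ring_scope.

Set Implicit Arguments.
Unset Strict Implicit.
Unset Printing Implicit Defensive.

(** * Iterated Lebesgue integrals *)

(** The multiple integral is only available as an iterated one, so each tool is rebuilt by induction
    on the number of variables. Dominated convergence survives this induction because the majorant
    is a product: freezing one variable leaves a majorant of the same kind. The only substitutions
    are diagonal affine maps and a reflection that changes the omitted coordinate. The omitted
    coordinate [k] has to lie outside Z: being a function of the others, it cannot have its factor
    absorbed in a one-variable density, so that factor must be bounded near [ths]. This choice also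
    makes every index of Z a free variable. Away from [ths] the density may be unbounded; there only
    the exponential is estimated and the density is integrated as it is. This is one reason to prove
    that the Dirichlet normalisation is finite, using for each [k] the chart omitting [k] on the
    part of the simplex where that coordinate is at least [1/K]. The constant is [L / B], with [L]
    the integral of the limit integrand and [B] the normalisation. *)

Section LebInt.
Context {R : realType}.
Local Open Scope ereal_scope.
Notation mu := (@lebesgue_measure R).

Lemma leb_int_ge0 n (f : n.-tuple R -> \bar R) :
  (forall t, 0 <= f t) -> 0 <= leb_int f.
Proof.
elim: n f => [|n IH] f f0 /=; first exact: f0.
by apply: integral_ge0 => x _; apply: IH => t; exact: f0.
Qed.

(** The parameter space is generalised in the induction: one coordinate of the tuple joins the
    parameter, so the induction hypothesis is used at [T * R], and Tonelli's theorem then integrates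
    that coordinate out. *)
Lemma measurable_leb_int d (T : measurableType d) n
    (f : T -> n.-tuple R -> \bar R) :
  measurable_fun setT (fun z : T * n.-tuple R => f z.1 z.2) ->
  (forall x t, 0 <= f x t) ->
  measurable_fun setT (fun x => leb_int (f x)).
Proof.
elim: n d T f => [|n IH] d T f mf f0 /=.
  have mh : measurable_fun setT (fun x : T => (x, [tuple] : 0.-tuple R)).
    exact: measurable_fun_pair.
  exact: (measurableT_comp mf mh).
pose g (z : T * R) (t : n.-tuple R) := f z.1 [tuple of z.2 :: t].
have mg : measurable_fun setT (fun z => leb_int (g z)).
  apply: IH => [|z t]; last exact: f0.
  have mh : measurable_fun setT (fun z : T * R * n.-tuple R =>
      (z.1.1, [tuple of z.1.2 :: z.2] : n.+1.-tuple R)).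
    apply: measurable_fun_pair => /=.
      exact: (measurableT_comp measurable_fst measurable_fst).
    apply: (measurable_cons (f := fun z : T * R * n.-tuple R => z.1.2)) => //.
    exact: (measurableT_comp measurable_snd measurable_fst).
  exact: (measurableT_comp mf mh).
apply: (@measurable_fun_fubini_tonelli_F _ _ T (measurableTypeR R) R mu
   (fun z => leb_int (g z))) => //.
by move=> z; apply: leb_int_ge0 => t; exact: f0.
Qed.

Lemma measurable_tuple_cons_l n (f : n.+1.-tuple R -> \bar R) (x : R) :
  measurable_fun setT f ->
  measurable_fun setT (fun t : n.-tuple R => f [tuple of x :: t]).
Proof.
move=> mf; apply: (measurableT_comp mf
  (measurable_cons (f := fun=> x) (g := fun t : n.-tuple R => t) _ _)) => //.
Qed.

Lemma measurable_tuple_cons n (f : n.+1.-tuple R -> \bar R) :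
  measurable_fun setT f ->
  measurable_fun setT (fun z : R * n.-tuple R => f [tuple of z.1 :: z.2]).
Proof.
move=> mf; apply: (measurableT_comp mf (measurable_cons
  (f := fun z : R * n.-tuple R => z.1) (g := fun z => z.2) _ _)).
  exact: measurable_fst.
exact: measurable_snd.
Qed.

Lemma measurable_leb_int_cons n (f : n.+1.-tuple R -> \bar R) :
  measurable_fun setT f -> (forall t, 0 <= f t) ->
  measurable_fun setT
    (fun x : measurableTypeR R => leb_int (fun t : n.-tuple R => f [tuple of x :: t])).
Proof.
move=> mf f0; apply: (measurable_leb_int
  (f := fun (x : measurableTypeR R) (t : n.-tuple R) => f [tuple of x :: t])).
  exact: measurable_tuple_cons.
by move=> x t; exact: f0.
Qed.

Lemma le_leb_int n (f g : n.-tuple R -> \bar R) :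
  measurable_fun setT f -> measurable_fun setT g ->
  (forall t, 0 <= f t) -> (forall t, f t <= g t) -> leb_int f <= leb_int g.
Proof.
elim: n f g => [|n IH] f g mf mg f0 fg /=; first exact: fg.
have g0 t : 0 <= g t by exact: le_trans (f0 t) (fg t).
apply: ge0_le_integral => //.
- by move=> x _; exact: leb_int_ge0.
- exact: measurable_leb_int_cons.
- exact: measurable_leb_int_cons.
- by move=> x _; apply: IH => //; exact: measurable_tuple_cons_l.
Qed.

Lemma leb_intD n (f g : n.-tuple R -> \bar R) :
  measurable_fun setT f -> measurable_fun setT g ->
  (forall t, 0 <= f t) -> (forall t, 0 <= g t) ->
  leb_int (fun t => f t + g t) = leb_int f + leb_int g.
Proof.
elim: n f g => [//|n IH] f g mf mg f0 g0 /=.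
rewrite -ge0_integralD//.
- apply: eq_integral => x _; rewrite IH//; exact: measurable_tuple_cons_l.
- by move=> x _; exact: leb_int_ge0.
- exact: measurable_leb_int_cons.
- by move=> x _; exact: leb_int_ge0.
- exact: measurable_leb_int_cons.
Qed.

Lemma leb_intZl n (c : R) (f : n.-tuple R -> \bar R) :
  measurable_fun setT f -> (forall t, 0 <= f t) -> (0 <= c)%R ->
  leb_int (fun t => c%:E * f t) = c%:E * leb_int f.
Proof.
elim: n f => [//|n IH] f mf f0 c0 /=.
rewrite -ge0_integralZl_EFin//.
- apply: eq_integral => x _; rewrite IH//; exact: measurable_tuple_cons_l.
- by move=> x _; exact: leb_int_ge0.
- exact: measurable_leb_int_cons.
Qed.

Lemma leb_int_sum n (I : Type) (s : seq I) (f : I -> n.-tuple R -> \bar R) :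
  (forall i, measurable_fun setT (f i)) -> (forall i t, 0 <= f i t) ->
  leb_int (fun t => \sum_(i <- s) f i t) = \sum_(i <- s) leb_int (f i).
Proof.
move=> mf f0; elim: s => [|i s IH].
  under eq_fun do rewrite big_nil.
  rewrite big_nil; elim: n {f mf f0} => [//|n IH] /=.
  by apply: integral0_eq => x _; exact: IH.
under eq_fun do rewrite big_cons.
rewrite big_cons leb_intD ?IH//.
- by apply: (@emeasurable_sum _ (n.-tuple R) R setT I s f) => i0; exact: mf.
- by move=> t; elim: s {IH} => [|j s IHs]; rewrite ?big_nil// big_cons adde_ge0.
Qed.

Lemma prod_integral_fin_num n (g : 'I_n -> R -> R) :
  (forall i x, 0 <= g i x)%R -> (forall i, \int[mu]_x (g i x)%:E < +oo) ->
  \prod_(i < n) \int[mu]_x (g i x)%:E \is a fin_num.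
Proof.
move=> g0 gi; apply: (big_ind (fun x => x \is a fin_num)) => //.
  by move=> x y; exact: fin_numM.
move=> i _; rewrite ge0_fin_numE//.
by apply: integral_ge0 => x _; rewrite lee_fin.
Qed.

(** Finiteness of the factors lets the product of the inner integrals leave the outer integral as a
    real constant. *)
Lemma leb_int_prod n (g : 'I_n -> R -> R) :
  (forall i, measurable_fun setT (g i)) -> (forall i x, 0 <= g i x)%R ->
  (forall i, \int[mu]_x (g i x)%:E < +oo) ->
  leb_int (fun t => (\prod_(i < n) g i (tnth t i))%:E) =
    \prod_(i < n) \int[mu]_x (g i x)%:E.
Proof.
elim: n g => [|n IH] g mg g0 gi /=; first by rewrite !big_ord0.
have prodfin := prod_integral_fin_num (fun i x => g0 (lift ord0 i) x)
  (fun i => gi (lift ord0 i)).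
transitivity (\int[mu]_x ((g ord0 x)%:E *
   \prod_(i < n) \int[mu]_x (g (lift ord0 i) x)%:E)).
  apply: eq_integral => x _; rewrite -IH// -leb_intZl//.
  - congr leb_int; apply/funext => t.
    rewrite big_ord_recl EFinM /=; congr (_ * _)%:E => //.
    by apply: eq_bigr => i _; rewrite tnthS.
  - apply/measurable_EFinP; apply: measurable_prod => i _.
    by apply: measurableT_comp => //; exact: measurable_tnth.
  - by move=> t; rewrite lee_fin prodr_ge0.
rewrite big_ord_recl -(fineK prodfin) ge0_integralZr//.
- by apply/measurable_EFinP; exact: mg.
- by move=> x _; rewrite lee_fin.
- rewrite lee_fin fine_ge0// prode_ge0// => i _.
  by apply: integral_ge0 => x _; rewrite lee_fin.
Qed.

End LebInt.

(** * Affine substitution in one variable *)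

Section Affine.
Context {R : realType}.
Local Open Scope ereal_scope.
Notation mu := (@lebesgue_measure R).
Variables (a b : R).
Hypothesis b0 : b != 0%R.

Let phi (x : measurableTypeR R) : measurableTypeR R := (a + b * x)%R.

Let mphi : measurable_fun setT phi.
Proof. by apply: measurable_funD => //; exact: measurable_funM. Qed.

Let pushm : {measure set (measurableTypeR R) -> \bar R} :=
  measure_function_pushforward__canonical__measure_function_Measure mu mphi.

(** By uniqueness of Lebesgue measure it suffices to compare on half-open intervals. A negative [b]
    exchanges the open and the closed end of the preimage, which leaves its length unchanged. *)
Let lebesgue_measure_affine (A : set R) : measurable A ->
  mu A = mscale (`|b|%:nng)%R pushm A.
Proof.
move=> mA; apply: lebesgue_measure_unique => //= _ [[c d]] _ <-.
rewrite /mscale /pushm/= /pushforward/=.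
have cd x y : (b * x < y = if (0 < b) then x < y / b else y / b < x)%R.
  case: ifPn => b0'; first by rewrite ltr_pdivlMr// mulrC.
  have b0'' : (b < 0)%R by rewrite lt_neqAle b0 leNgt.
  by rewrite ltr_ndivrMr// mulrC.
have [bp|bn] := ltP 0%R b.
- rewrite (_ : phi @^-1` _ = `]((c - a) / b)%R, ((d - a) / b)%R]%classic).
    rewrite !lebesgue_measure_itv/= !lte_fin ltr_pM2r ?invr_gt0// ltrD2r.
    case: ifPn => _; last by rewrite mule0.
    by rewrite -!EFinB -EFinM (gtr0_norm bp); congr (_%:E); field.
  apply/seteqP; split => x /=; rewrite !in_itv/= /phi => /andP[].
    by move=> h1 h2; rewrite ltr_pdivrMr// ler_pdivlMr// ltrBlDl lerBrDl mulrC h1.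
  by rewrite ltr_pdivrMr// ler_pdivlMr// ltrBlDl lerBrDl (mulrC x) => -> ->.
- have {}bn : (b < 0)%R by rewrite lt_neqAle b0.
  rewrite (_ : phi @^-1` _ = `[((d - a) / b)%R, ((c - a) / b)%R[%classic).
    rewrite !lebesgue_measure_itv/= !lte_fin ltr_nM2r ?invr_lt0// ltrD2r.
    case: ifPn => _; last by rewrite mule0.
    by rewrite -!EFinB -EFinM (ltr0_norm bn); congr (_%:E); field.
  apply/seteqP; split => x /=; rewrite !in_itv/= /phi => /andP[].
    by move=> h1 h2; rewrite ltr_ndivlMr// ler_ndivrMr// ltrBlDl lerBrDl (mulrC x) h1 h2.
  by rewrite ltr_ndivlMr// ler_ndivrMr// ltrBlDl lerBrDl (mulrC x) => -> ->.
Qed.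

(** Positive slopes serve the rescaling; slope -1 serves the reflection of the simplex. *)
Lemma ge0_integral_affine (f : R -> \bar R) :
  measurable_fun setT f -> (forall x, 0 <= f x) ->
  \int[mu]_x f x = `|b|%:E * \int[mu]_x f (a + b * x)%R.
Proof.
move=> mf f0.
rewrite (eq_measure_integral (mscale (`|b|%:nng)%R pushm)).
  rewrite ge0_integral_mscale//; congr (_ * _).
  by rewrite ge0_integral_pushforward.
by move=> A mA _; exact: lebesgue_measure_affine.
Qed.

End Affine.

(** * Positivity, dominated convergence and diagonal scaling *)

Section LebIntConvergence.
Context {R : realType}.
Local Open Scope ereal_scope.
Notation mu := (@lebesgue_measure R).

(** A zero integral would make [h] vanish almost everywhere, although it is positive on an interval
    of measure [b - a]. *)
Lemma integral_gt0 (h : R -> \bar R) (a b : R) : (a < b)%R ->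
  measurable_fun setT h -> (forall x, 0 <= h x) ->
  (forall x, (a < x < b)%R -> 0 < h x) -> 0 < \int[mu]_x h x.
Proof.
move=> ab mh h0 hpos; rewrite lt_neqAle integral_ge0// andbT eq_sym.
apply/negP => /eqP hI.
have : ae_eq mu setT h (cst 0).
  apply/(ae_eq_integral_abs mu measurableT mh).
  by under eq_integral do rewrite gee0_abs//.
case=> N [mN N0 sub].
have : mu `]a, b[%classic <= 0.
  rewrite -[leRHS]N0; apply: le_measure; rewrite ?inE//.
  move=> x /=; rewrite in_itv/= => xab; apply: sub => /= /(_ I) hx.
  by have := hpos _ xab; rewrite hx ltxx.
by rewrite lebesgue_measure_itv/= lte_fin ab -EFinB lee_fin subr_le0 leNgt ab.
Qed.

Lemma leb_int_gt0 n (f : n.-tuple R -> \bar R) (a b : R) : (a < b)%R ->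
  measurable_fun setT f -> (forall t, 0 <= f t) ->
  (forall t, (forall i, (a < tnth t i < b)%R) -> 0 < f t) -> 0 < leb_int f.
Proof.
move=> ab; elim: n f => [|n IH] f mf f0 fpos /=; first by apply: fpos => -[].
apply: (integral_gt0 ab).
- exact: measurable_leb_int_cons.
- by move=> x; exact: leb_int_ge0.
- move=> x xab; apply: IH => //; first exact: measurable_tuple_cons_l.
  move=> t tab; apply: fpos => i.
  by case: (unliftP ord0 i) => [j ->|->] //; rewrite tnthS.
Qed.

(** With the first variable frozen at [x], the majorant keeps its product form with constant
    [c * g ord0 x], so the inner integrals converge by induction. They are bounded by a constant
    times [g ord0 x], which lets the one-dimensional theorem handle the outer integral. *)
Lemma leb_int_dominated_cvg n (f_ : nat -> n.-tuple R -> \bar R)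
    (f : n.-tuple R -> \bar R) (g : 'I_n -> R -> R) (c : R) :
  (forall k, measurable_fun setT (f_ k)) -> (forall k t, 0 <= f_ k t) ->
  (forall t, f_ ^~ t @ \oo --> f t) ->
  (forall i, measurable_fun setT (g i)) -> (forall i x, 0 <= g i x)%R ->
  (forall i, \int[mu]_x (g i x)%:E < +oo) -> (0 <= c)%R ->
  (forall k t, f_ k t <= (c * \prod_(i < n) g i (tnth t i))%:E) ->
  leb_int (f_ k) @[k --> \oo] --> leb_int f.
Proof.
elim: n f_ f g c => [|n IH] f_ f g c mf f0 ff mg g0 gi c0 fg.
  exact: ff.
rewrite /=.
pose P := \prod_(i < n) \int[mu]_x (g (lift ord0 i) x)%:E.
have Pfin : P \is a fin_num by exact: prod_integral_fin_num.
have mprod : measurable_fun setT (fun t : n.-tuple R =>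
    (\prod_(i < n) g (lift ord0 i) (tnth t i))%:E).
  apply/measurable_EFinP; apply: measurable_prod => i _.
  by apply: measurableT_comp => //; exact: measurable_tnth.
have prod0 (t : n.-tuple R) : 0 <= (\prod_(i < n) g (lift ord0 i) (tnth t i))%:E.
  by rewrite lee_fin prodr_ge0.
have fgx k x (t : n.-tuple R) : f_ k [tuple of x :: t] <=
    (c * g ord0 x * \prod_(i < n) g (lift ord0 i) (tnth t i))%:E.
  apply: (le_trans (fg _ _)); rewrite big_ord_recl -mulrA lee_fin.
  by under eq_bigr do rewrite tnthS.
apply: (@dominated_cvg _ _ _ mu setT measurableT
   (fun k x => leb_int (fun t : n.-tuple R => f_ k [tuple of x :: t])) _
   (fun x => (c * g ord0 x * fine P)%:E)).
- by move=> k; exact: measurable_leb_int_cons.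
- move=> x _; apply: (IH _ _ (fun i => g (lift ord0 i)) (c * g ord0 x)%R) => //.
  + by move=> k; exact: measurable_tuple_cons_l.
  + by rewrite mulr_ge0.
- by [].
- apply/integrableP; split.
    apply/measurable_EFinP; apply: measurable_funM => //.
    apply: measurable_funM => //; exact: mg.
  have P0 : (0 <= fine P)%R.
    rewrite fine_ge0// prode_ge0// => i _.
    by apply: integral_ge0 => x _; rewrite lee_fin.
  under eq_integral => x _.
    rewrite gee0_abs ?lee_fin ?mulr_ge0// mulrAC EFinM.
    over.
  rewrite /= ge0_integralZl_EFin ?mulr_ge0//.
  + by rewrite lte_mul_pinfty// lee_fin mulr_ge0.
  + by move=> x _; rewrite lee_fin.
  + by apply/measurable_EFinP; exact: mg.
- move=> k x _; rewrite gee0_abs ?leb_int_ge0//.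
  rewrite EFinM fineK// -[P]leb_int_prod// -leb_intZl ?mulr_ge0//.
  apply: le_leb_int => //.
  + exact: measurable_tuple_cons_l.
  + exact: measurable_funeM.
Qed.

Definition affine_tuple n (a b : 'I_n -> R) (t : n.-tuple R) : n.-tuple R :=
  [tuple (a i + b i * tnth t i)%R | i < n].

Lemma leb_int_affine n (a b : 'I_n -> R) (f : n.-tuple R -> \bar R) :
  measurable_fun setT f -> (forall t, 0 <= f t) -> (forall i, 0 < b i)%R ->
  leb_int f = (\prod_(i < n) b i)%:E * leb_int (f \o affine_tuple a b).
Proof.
elim: n a b f => [|n IH] a b f mf f0 b0.
  by rewrite big_ord0 mul1e /=; congr f; apply: eq_from_tnth => -[].
have mf' x : measurable_fun setT (fun t : n.-tuple R => f [tuple of x :: t]).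
  exact: measurable_tuple_cons_l.
have maff (m : nat) (a' b' : 'I_m -> R) : measurable_fun setT (affine_tuple a' b').
  apply/measurable_fun_tnthP => i; rewrite [X in measurable_fun _ X](_ : _ =
    (fun t : m.-tuple R => a' i + b' i * tnth t i)%R); last first.
    by apply/funext => t /=; rewrite tnth_mktuple.
  apply: measurable_funD => //; apply: measurable_funM => //.
  exact: measurable_tnth.
rewrite /= (@ge0_integral_affine _ (a ord0) (b ord0)) ?gt_eqF//; last 2 first.
- exact: measurable_leb_int_cons.
- by move=> x; exact: leb_int_ge0.
rewrite (gtr0_norm (b0 _)) big_ord_recl EFinM -muleA; congr (_ * _).
rewrite -ge0_integralZl_EFin//; last 3 first.
- by move=> x _; exact: leb_int_ge0.
- apply: (measurable_leb_int_cons (f := f \o affine_tuple a b)).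
    exact: (measurableT_comp mf (maff _ _ _)).
  by move=> t; exact: f0.
- by apply: prodr_ge0 => i _; exact: ltW.
apply: eq_integral => x _.
rewrite (IH (fun i => a (lift ord0 i)) (fun i => b (lift ord0 i)))//.
congr (_ * leb_int _); apply/funext => t /=; congr f; apply: eq_from_tnth => i.
rewrite tnth_mktuple; case: (unliftP ord0 i) => [j ->|->] //.
by rewrite !tnthS tnth_mktuple.
Qed.

End LebIntConvergence.

(** * Reordering the variables and reflecting the simplex *)

Section Insert.
Context {R : realType}.
Local Open Scope ereal_scope.
Notation mu := (@lebesgue_measure R).

Definition insert_tuple n (k : 'I_n.+1) (x : R) (t : n.-tuple R) : n.+1.-tuple R :=
  [tuple if unlift k i is Some j then tnth t j else x | i < n.+1].

Lemma measurable_insert_tuple d (T : measurableType d) n (k : 'I_n.+1)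
    (f : T -> R) (g : T -> n.-tuple R) :
  measurable_fun setT f -> measurable_fun setT g ->
  measurable_fun setT (fun z => insert_tuple k (f z) (g z)).
Proof.
move=> mf mg; apply/measurable_fun_tnthP => i.
case: (unliftP k i) => [j ij|ik].
  rewrite [X in measurable_fun _ X](_ : _ = (fun z => tnth (g z) j)).
    exact: (measurableT_comp (measurable_tnth j) mg).
  by apply/funext => z /=; rewrite tnth_mktuple ij liftK.
rewrite [X in measurable_fun _ X](_ : _ = f) //.
by apply/funext => z /=; rewrite tnth_mktuple ik unlift_none.
Qed.

Lemma insert_tuple_cons n (k : 'I_n.+1) (x y : R) (t : n.-tuple R) :
  [tuple of y :: insert_tuple k x t] =
  insert_tuple (lift ord0 k) x [tuple of y :: t].
Proof.
apply: eq_from_tnth => i; rewrite tnth_mktuple.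
case: (unliftP ord0 i) => [i' ->|->]; last first.
  have -> : ord0 = lift (lift ord0 k) ord0 :> 'I_n.+2 by apply/val_inj.
  by rewrite liftK.
rewrite tnthS tnth_mktuple.
case: (unliftP k i') => [j ->|->]; last by rewrite unlift_none.
have -> : lift ord0 (lift k j) = lift (lift ord0 k) (lift ord0 j) :> 'I_n.+2.
  by apply/val_inj => /=; rewrite /bump !leq0n !add1n ltnS addnS.
by rewrite liftK tnthS.
Qed.

Lemma leb_intS n (f : n.+1.-tuple R -> \bar R) :
  leb_int f = \int[mu]_x leb_int (fun t : n.-tuple R => f [tuple of x :: t]).
Proof. by []. Qed.

(** The variable in position [k] is brought to the front by exchanging it, through Tonelli, with
    each variable that precedes it. *)
Lemma leb_int_insert n (k : 'I_n.+1) (f : n.+1.-tuple R -> \bar R) :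
  measurable_fun setT f -> (forall t, 0 <= f t) ->
  leb_int f = \int[mu]_x leb_int (fun t => f (insert_tuple k x t)).
Proof.
elim: n k f => [|n IH] k f mf f0.
  rewrite /=; apply: eq_integral => x _; congr f; apply: eq_from_tnth => i.
  by rewrite tnth_mktuple !ord1 unlift_none.
case: (unliftP ord0 k) => [k' ->|->]; last first.
  rewrite leb_intS; apply: eq_integral => x _.
  congr leb_int; apply/funext => t; congr f.
  apply: eq_from_tnth => i; rewrite tnth_mktuple.
  by case: (unliftP ord0 i) => [j ->|->] //; rewrite tnthS.
transitivity (\int[mu]_y \int[mu]_x leb_int (fun t : n.-tuple R =>
    f [tuple of y :: insert_tuple k' x t])).
  rewrite leb_intS; apply: eq_integral => y _.
  by apply: (IH k') => [|t]; [exact: measurable_tuple_cons_l|exact: f0].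
pose h (z : measurableTypeR R * measurableTypeR R) :=
  leb_int (fun t : n.-tuple R => f [tuple of z.1 :: insert_tuple k' z.2 t]).
have mh : measurable_fun setT h.
  apply: (measurable_leb_int
    (f := fun (z : measurableTypeR R * measurableTypeR R) (t : n.-tuple R) =>
       f [tuple of z.1 :: insert_tuple k' z.2 t])) => //.
  apply: (measurableT_comp mf (measurable_cons
    (f := fun u : measurableTypeR R * measurableTypeR R * n.-tuple R => u.1.1) _ _)).
    exact: (measurableT_comp measurable_fst measurable_fst).
  apply: measurable_insert_tuple => //.
  exact: (measurableT_comp measurable_snd measurable_fst).
have h0 z : 0 <= h z by exact: leb_int_ge0.
rewrite (fubini_tonelli h mh h0); apply: eq_integral => x _.
rewrite leb_intS; apply: eq_integral => y _; rewrite /h/=; congr leb_int; apply/funext => t.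
by rewrite insert_tuple_cons.
Qed.

Lemma leb_int_tonelli n (f : measurableTypeR R -> n.-tuple R -> \bar R) :
  measurable_fun setT (fun z : measurableTypeR R * n.-tuple R => f z.1 z.2) ->
  (forall x t, 0 <= f x t) ->
  \int[mu]_x leb_int (f x) = leb_int (fun t => \int[mu]_x f x t).
Proof.
elim: n f => [//|n IH] f mf f0 /=.
pose h (z : measurableTypeR R * measurableTypeR R) :=
  leb_int (fun t : n.-tuple R => f z.1 [tuple of z.2 :: t]).
have mh : measurable_fun setT h.
  apply: (measurable_leb_int
    (f := fun (z : measurableTypeR R * measurableTypeR R) (t : n.-tuple R) =>
       f z.1 [tuple of z.2 :: t])) => //.
  apply: (measurableT_comp mf (measurable_fun_pair (f :=
     fun u : measurableTypeR R * measurableTypeR R * n.-tuple R => u.1.1) _ _)).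
    exact: (measurableT_comp measurable_fst measurable_fst).
  apply: (measurable_cons
    (f := fun u : measurableTypeR R * measurableTypeR R * n.-tuple R => u.1.2)) => //.
  exact: (measurableT_comp measurable_snd measurable_fst).
have h0 z : 0 <= h z by exact: leb_int_ge0.
rewrite (fubini_tonelli h mh h0); apply: eq_integral => y _.
apply: IH => // {mh h0 h}.
apply: (measurableT_comp mf (measurable_fun_pair (f :=
     fun u : measurableTypeR R * n.-tuple R => u.1) _ _)).
  exact: measurable_fst.
apply: (measurable_cons (f := fun=> y)
  (g := fun u : measurableTypeR R * n.-tuple R => u.2)) => //.
exact: measurable_snd.
Qed.

Definition reflect_tuple n (k : 'I_n) (t : n.-tuple R) : n.-tuple R :=
  [tuple if i == k then (1 - \sum_(j < n) tnth t j)%R else tnth t i | i < n].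

(* The reflection exchanges the value of the coordinate [k] with that of the
   coordinate that [complete_pt] adds. *)
Lemma leb_int_reflect n (k : 'I_n) (f : n.-tuple R -> \bar R) :
  measurable_fun setT f -> (forall t, 0 <= f t) ->
  leb_int f = leb_int (f \o reflect_tuple k).
Proof.
case: n k f => [[]//|n] k f mf f0.
have mins d (T : measurableType d) (g : T -> R) (h : T -> n.-tuple R) :
    measurable_fun setT g -> measurable_fun setT h ->
    measurable_fun setT (fun z => f (insert_tuple k (g z) (h z))).
  by move=> mg mh; exact: (measurableT_comp mf (measurable_insert_tuple k mg mh)).
have msum : measurable_fun setT (fun t : n.-tuple R => \sum_(j < n) tnth t j)%R.
  by apply: measurable_sum => i; exact: measurable_tnth.
rewrite (leb_int_insert k mf f0) [RHS](leb_int_insert k); last 2 first.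
- apply: (measurableT_comp mf); apply/measurable_fun_tnthP => i.
  rewrite [X in measurable_fun _ X](_ : _ = (fun t : n.+1.-tuple R =>
    if i == k then (1 - \sum_(j < n.+1) tnth t j)%R else tnth t i)); last first.
    by apply/funext => t /=; rewrite tnth_mktuple.
  case: (i == k); last exact: measurable_tnth.
  apply: measurable_funB => //.
  by apply: measurable_sum => j; exact: measurable_tnth.
- by move=> t; exact: f0.
rewrite leb_int_tonelli//; last by apply: mins.
(* With the other coordinates frozen, the reflection is an affine map of slope -1 in the coordinate
   [k]. Tonelli puts that coordinate innermost, where the substitution preserves the integral. *)
have reflE x t : reflect_tuple k (insert_tuple k x t) =
    insert_tuple k ((1 - \sum_(j < n) tnth t j) + -1 * x)%R t.
  apply: eq_from_tnth => i; rewrite !tnth_mktuple.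
  case: (unliftP k i) => [j ->|->]; first by rewrite eq_sym (negbTE (neq_lift _ _)).
  rewrite eqxx (bigD1_ord k)//= tnth_mktuple unlift_none.
  under eq_bigr do rewrite tnth_mktuple liftK.
  by rewrite mulN1r opprD addrA addrAC.
transitivity (leb_int (fun t : n.-tuple R => \int[mu]_x f (insert_tuple k
    ((1 - \sum_(j < n) tnth t j) + -1 * x)%R t))).
  congr leb_int; apply/funext => t.
  rewrite (@ge0_integral_affine _ (1 - \sum_(j < n) tnth t j)%R (-1)) ?oppr_eq0 ?oner_eq0//.
    by rewrite normrN normr1 mul1e.
  exact: mins.
rewrite -leb_int_tonelli//.
  apply: eq_integral => x _; congr leb_int; apply/funext => t /=.
  by rewrite reflE.
apply: (mins _ (measurableTypeR R * n.-tuple R)%type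
  (fun z => (1 - \sum_(j < n) tnth z.2 j) + -1 * z.1)%R (fun z => z.2)); last exact: measurable_snd.
apply: measurable_funD; last first.
  by apply: measurable_funM => //; exact: measurable_fst.
apply: measurable_funB => //.
exact: (measurableT_comp msum measurable_snd).
Qed.

Lemma complete_ptE N (t : N.-tuple R) (i : 'I_N.+1) :
  @complete_pt R N.+1 t 0%R i =
  if unlift ord_max i is Some j then tnth t j else (1 - \sum_(j < N) tnth t j)%R.
Proof.
rewrite mxE; case: (unliftP ord_max i) => [j ->|->].
  by rewrite lift_max ltn_ord (tnth_nth (0 : R)%R).
by rewrite ltnn big_tuple.
Qed.

End Insert.

(** * Functions of a row vector *)

Section MeasRow.
Context {R : realType} d (T : measurableType d) (K : nat).
Variable X : T -> 'rV[R]_K.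
Hypothesis mX : forall i, measurable_fun setT (fun t => X t 0 i).

(** Measurability of [X] is known only by coordinates. An open set is a countable union of boxes
    with rational centre and radius [1/(m+1)], and the preimage of a box is a finite intersection of
    coordinate conditions. *)
Lemma measurable_preimage_open (V : set 'rV[R]_K) :
  open V -> measurable (X @^-1` V).
Proof.
move=> oV.
pose B (q : {ffun 'I_K -> rat} * nat) : set 'rV[R]_K :=
  [set v | forall i, `|v 0 i - ratr (q.1 i)| < q.2.+1%:R^-1].
(* Boxes not contained in [V] are replaced by the empty set, so that the union runs over a whole
   countable type. *)
pose F q : set T := if `[< B q `<=` V >] then X @^-1` (B q) else set0.
have -> : X @^-1` V = \bigcup_q F q.
  apply/seteqP; split => [t /= Vt|t [q _]]; last first.
    by rewrite /F; case: asboolP => // BV Bt; exact: BV.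
  have /nbhs_ballP[e /= e0 eV] : nbhs (X t) V by exact: open_nbhs_nbhs.
  have [m] : exists m : nat, m.+1%:R^-1 < e / 2.
    have e20 : 0 < e / 2 by rewrite divr_gt0.
    have [m _ /(_ m (leqnn m)) hm] := near_infty_natSinv_lt (PosNum e20).
    by exists m.
  move=> me.
  have /choice[q hq] : forall i, exists q : rat, `|X t 0 i - ratr q| < m.+1%:R^-1.
    move=> i; have /rat_in_itvoo[q] :
      X t 0 i - m.+1%:R^-1 < X t 0 i + m.+1%:R^-1.
      by rewrite ltrD2l gtrN// invr_gt0.
    by rewrite in_itv/= -ltr_distl distrC; exists q.
  exists ([ffun i => q i], m) => //.
  have BV : B ([ffun i => q i], m) `<=` V.
    move=> v Bv; apply: eV; split=> // i j; rewrite ord1 /ball/=.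
    have := Bv j; rewrite ffunE/= => h.
    rewrite (_ : X t 0 j - v 0 j = (X t 0 j - ratr (q j)) - (v 0 j - ratr (q j))).
      apply: (le_lt_trans (ler_normB _ _)).
      by rewrite (splitr e) ltrD// (lt_trans _ me).
    by ring.
  rewrite /F; case: asboolP => // _ i /=; rewrite ffunE; exact: hq.
apply: countable_bigcupT_measurable; first exact: countableP.
move=> q; rewrite /F; case: asboolP => // _.
rewrite (_ : _ @^-1` _ = \bigcap_(i in [set: 'I_K])
   ((fun t => X t 0 i) @^-1` `](ratr (q.1 i) - q.2.+1%:R^-1),
      (ratr (q.1 i) + q.2.+1%:R^-1)[%classic)).
  apply: fin_bigcap_measurable => // i _.
  by rewrite -[X in measurable X]setTI; exact: mX.
apply/seteqP; split => t /= h i.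
  by move=> _; have := h i; rewrite /= in_itv/= ltr_distl.
by have := h i I; rewrite /= in_itv/= ltr_distl.
Qed.

Lemma measurable_preimage_closed (V : set 'rV[R]_K) :
  closed V -> measurable (X @^-1` V).
Proof.
move=> cV; rewrite -[X in measurable X]setCK; apply: measurableC.
exact: (measurable_preimage_open (closed_openC cV)).
Qed.

(** Sets open in the subspace are traces of open sets. This form is needed because [H] is assumed
    continuous only relative to the simplex. *)
Lemma measurable_fun_within (S : set 'rV[R]_K) (h : 'rV[R]_K -> R) :
  closed S -> {within S, continuous h} ->
  measurable_fun (X @^-1` S) (h \o X).
Proof.
move=> cS ch mD; apply: (measurability _ (RGenOpens.measurableE R)).
move=> _ [_ [a [b ->] <-]].
have /open_subspaceP[V oV VS] :
    open ((h : subspace S -> R) @^-1` `]a, b[%classic : set (subspace S)).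
  by move/continuousP : ch; apply; exact: interval_open.
rewrite (_ : _ `&` _ = X @^-1` V `&` X @^-1` S); last first.
  apply/seteqP; split => t.
    move=> [St ht]; have : (h @^-1` `]a, b[ `&` S) (X t) by [].
    by rewrite -VS.
  by rewrite -preimage_setI VS => -[].
apply: measurableI => //; exact: measurable_preimage_open.
by [].
Qed.

End MeasRow.

Section Simplex.
Context {R : realType} (K : nat).

Lemma sum_coord_continuous (P : pred 'I_K) : continuous (fun v : 'rV[R]_K => \sum_(i < K | P i) v 0 i).
Proof.
move=> v; have FF : Filter (nbhs v) by exact: nbhs_filter.
apply: cvg_big => [|i _]; last exact: coord_continuous.
exact: add_continuous.
Qed.

Lemma closed_simplex : closed (@simplex R K).
Proof.
rewrite (_ : @simplex R K = (\bigcap_i [set v | 0 <= v 0 i]) `&`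
   (fun v => \sum_(i < K) v 0 i) @^-1` [set 1]).
  apply: closedI.
    apply: closed_bigI => i _.
    apply: (@preimage_closed _ _ (fun v : 'rV[R]_K => v 0 i) [set x | 0 <= x]).
      by move=> x _; exact: coord_continuous.
    exact: closed_ge.
  apply: preimage_closed; last exact: closed_eq.
  by move=> x _; exact: sum_coord_continuous.
by apply/seteqP; split => v [h1 h2]; split => // i; [move=> _|]; exact: (h1 i).
Qed.

Lemma simplex_le1 (v : 'rV[R]_K) i : simplex v -> v 0 i <= 1.
Proof.
by move=> [v0 <-]; rewrite (bigD1 i)//= lerDl sumr_ge0.
Qed.

Lemma compact_simplex : compact (@simplex R K).
Proof.
apply: (subclosed_compact closed_simplex
  (rV_compact (fun _ : 'I_K => @segment_compact R 0 1))) => v sv i /=.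
by rewrite in_itv/= simplex_le1// andbT; case: sv.
Qed.

End Simplex.

(** * Mean value estimates and the second-order expansion *)

Section MeanValue.
Context {R : realType} (K : nat).
Implicit Types (x y d v : 'rV[R]_K).

Lemma nbhs_rowP x (P : set 'rV[R]_K) :
  nbhs x P <-> exists2 r, 0 < r & forall y, (forall i, `|y 0 i - x 0 i| < r) -> P y.
Proof.
split=> [/nbhs_ballP[r /= r0 rP]|[r r0 rP]].
  exists r => // y yx; apply: rP; split => // i j; rewrite ord1 /ball/= distrC.
  exact: yx.
apply/nbhs_ballP; exists r => //= y [_ yx]; apply: rP => i.
by rewrite distrC; exact: yx.
Qed.

Lemma derive_line (g : 'rV[R]_K -> R) y v (s : R) :
  derivable g (y + s *: v) v ->
  is_derive s 1 (fun s => g (y + s *: v)) ('D_v g (y + s *: v)).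
Proof.
have E : (fun h : R => h^-1 *: (((fun s => g (y + s *: v)) \o shift s) (h *: 1) -
      g (y + s *: v))) =
    (fun h : R => h^-1 *: ((g \o shift (y + s *: v)) (h *: v) - g (y + s *: v))).
  apply/funext => h /=; congr (_ *: (g _ - _)).
  by rewrite [h *: 1]mulr1 scalerDl addrCA.
by move=> gd; apply: DeriveDef; rewrite /derivable /derive E.
Qed.

Lemma line_mvt (g : 'rV[R]_K -> R) y v (delta a eps : R) :
  (forall s : R, `|s| <= `|delta| -> derivable g (y + s *: v) v /\
     `|'D_v g (y + s *: v) - a| <= eps) ->
  `|g (y + delta *: v) - g y - a * delta| <= eps * `|delta|.
Proof.
move=> H.
pose phi (s : R) := g (y + s *: v).
have dphi (s : R) : `|s| <= `|delta| -> is_derive s 1 phi ('D_v g (y + s *: v)).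
  by move=> /H[? _]; exact: derive_line.
have cphi (i : interval R) : (forall s, s \in i -> `|s| <= `|delta|) ->
    {within [set` i], continuous phi}.
  move=> hi; apply: derivable_within_continuous => s /hi si.
  by have [] := dphi _ si.
have fin c : `|c| <= `|delta| ->
    `|('D_v g (y + c *: v) - a) * delta| <= eps * `|delta|.
  by move=> /H[_ h]; rewrite normrM ler_wpM2r.
have [d0|d0] := leP 0 delta.
  have hi s : s \in `[0, delta] -> `|s| <= `|delta|.
    by rewrite in_itv/= => /andP[s0 sd]; rewrite !ger0_norm.
  have [|s|c cd] := @MVT_segment R phi (fun s => 'D_v g (y + s *: v)) 0 delta d0.
  - move=> s sd; apply: dphi; apply: hi; exact: subset_itv_oo_cc sd.
  - exact: cphi.
  rewrite /phi scale0r addr0 subr0 => ->.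
  by rewrite -mulrBl; exact/fin/hi.
have hi s : s \in `[delta, 0] -> `|s| <= `|delta|.
  rewrite in_itv/= => /andP[s0 sd]; rewrite !ler0_norm ?lerN2//.
  exact: ltW.
have [|s|c cd] := @MVT_segment R phi (fun s => 'D_v g (y + s *: v)) delta 0 (ltW d0).
- move=> s sd; apply: dphi; apply: hi; exact: subset_itv_oo_cc sd.
- exact: cphi.
rewrite /phi scale0r addr0 sub0r => E.
rewrite -[X in `|X - _|]opprB E -mulrN opprK -mulrBl.
exact/fin/hi.
Qed.

(** The path from [x] to [x + d] changes one coordinate at a time, so only partial derivatives occur
    and every intermediate point stays in the box of radius [r]. The slopes [a] are arbitrary
    because they are a gradient in some uses and a row of the Hessian in another. *)
Lemma partial_mvt (g : 'rV[R]_K -> R) x d (r eps : R) (a : 'I_K -> R) :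
  (forall y, (forall i, `|y 0 i - x 0 i| < r) ->
     forall i, derivable g y (basis_vec i) /\ `|partial i g y - a i| <= eps) ->
  (forall i, `|d 0 i| < r) ->
  `|g (x + d) - g x - \sum_(i < K) a i * d 0 i| <= eps * \sum_(i < K) `|d 0 i|.
Proof.
move=> H dr.
pose dm m : 'rV[R]_K := \row_(i < K) (if (i < m)%N then d 0 i else 0).
have step m : (m <= K)%N ->
  `|g (x + dm m) - g x - \sum_(i < K | (i < m)%N) a i * d 0 i| <=
   eps * \sum_(i < K | (i < m)%N) `|d 0 i|.
  elim: m => [_|m IH mK].
    rewrite !big_pred0// (_ : dm 0%N = 0) ?addr0 ?subrr ?normr0 ?mulr0 ?subr0//.
    by apply/rowP => i; rewrite !mxE.
  pose im := Ordinal mK.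
  have dmS : dm m.+1 = dm m + d 0 im *: basis_vec im.
    apply/rowP => i; rewrite !mxE eqxx/= ltnS leq_eqVlt.
    have -> : (i == im) = (i == m :> nat) by [].
    case: eqVneq => [im'|im'] /=; last by rewrite mulr0 addr0.
    rewrite im' ltnn add0r mulr1; congr (d 0 _); exact: val_inj.
  have sumS (F : 'I_K -> R) : \sum_(i < K | (i < m.+1)%N) F i =
      F im + \sum_(i < K | (i < m)%N) F i.
    rewrite (bigD1 im)//=; congr (_ + _); apply: eq_bigl => i.
    rewrite ltnS (ltn_neqAle i m) andbC; congr (_ && _).
  rewrite !sumS mulrDr dmS addrA.
  have h2 : `|g (x + dm m + d 0 im *: basis_vec im) - g (x + dm m) -
      a im * d 0 im| <= eps * `|d 0 im|.
    apply: line_mvt => s sd; apply: H => i; rewrite !mxE.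
    have E (p q u : R) : p + q + u - p = q + u by ring.
    rewrite eqxx/= E {E}.
    have -> : (i == im) = (i == m :> nat) by [].
    case: ltngtP => im'; rewrite /= ?mulr0 ?addr0 ?mulr1 ?add0r//.
    - by rewrite normr0 (le_lt_trans _ (dr im)).
    - exact: (le_lt_trans sd).
  have := IH (ltnW mK); move: h2.
  move=> h2 h3; apply: (le_trans _ (lerD h2 h3)).
  rewrite (_ : _ - _ = (g (x + dm m + d 0 im *: basis_vec im) - g (x + dm m) -
      a im * d 0 im) + (g (x + dm m) - g x -
     \sum_(i < K | (i < m)%N) a i * d 0 i)); first exact: ler_normD.
  by ring.
have := step K (leqnn K).
rewrite (_ : dm K = d); last by apply/rowP => i; rewrite mxE ltn_ord.
rewrite (eq_bigl xpredT) => [|i]; last by rewrite ltn_ord.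
by rewrite [X in _ <= _ * X](eq_bigl xpredT) => [|i]; last by rewrite ltn_ord.
Qed.

End MeanValue.

Section Differentiability.
Context {R : realType} (K : nat).
Implicit Types (x y d v : 'rV[R]_K).

(** [C2_on] speaks only of derivatives along basis vectors, while the expansion at [ths] needs the
    derivative along an arbitrary segment. *)
Lemma derive_of_partials (g : 'rV[R]_K -> R) x v :
  (\forall y \near x, forall i, derivable g y (basis_vec i)) ->
  (forall i, {for x, continuous (partial i g)}) ->
  derivable g x v /\ 'D_v g x = \sum_(i < K) partial i g x * v 0 i.
Proof.
move=> gd gc; pose L := \sum_(i < K) partial i g x * v 0 i.
have cv : (fun h : R => h^-1 *: ((g \o shift x) (h *: v) - g x)) @ 0^' --> L.
  apply/cvgrPdist_le => e e0; pose S := \sum_(i < K) `|v 0 i|.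
  have S0 : 0 <= S by exact: sumr_ge0.
  (* The added 1 avoids a division by zero when [v = 0]. *)
  pose e' := e / (S + 1).
  have e'0 : 0 < e' by rewrite divr_gt0// ltr_wpDl.
  have /nbhs_rowP[r r0 rP] : \forall y \near x, forall i,
      derivable g y (basis_vec i) /\ `|partial i g y - partial i g x| <= e'.
    near=> y => i; split; first by move: i; near: y.
    move: i; near: y; apply: filter_forall => i.
    by have /cvgrPdistC_le := gc i; exact.
  near=> h.
  have h0 : h != 0 by near: h; exact: nbhs_dnbhs_neq.
  have hr i : `|(h *: v) 0 i| < r.
    rewrite mxE normrM (@le_lt_trans _ _ (`|h| * (S + 1)))//.
      rewrite ler_wpM2l// /S (bigD1 i)//= -addrA lerDl addr_ge0//.
      exact: sumr_ge0.
    rewrite -ltr_pdivlMr ?ltr_wpDl//.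
    near: h; apply: dnbhs0_lt; by rewrite divr_gt0// ltr_wpDl.
  have := @partial_mvt R K g x (h *: v) r e' (fun i => partial i g x) rP hr.
  rewrite /= (addrC _ x).
  have -> : \sum_(i < K) partial i g x * (h *: v) 0 i = h * L.
    by rewrite mulr_sumr; apply: eq_bigr => i _; rewrite mxE mulrCA.
  have -> : \sum_(i < K) `|(h *: v) 0 i| = `|h| * S.
    by rewrite mulr_sumr; apply: eq_bigr => i _; rewrite mxE normrM.
  move=> H1; rewrite -[L](mulKf h0) -mulrBr normrM normfV.
  rewrite ler_pdivrMl ?normr_gt0// distrC (le_trans H1)//.
  rewrite mulrCA ler_wpM2l// /e' mulrAC ler_pdivrMr ?ltr_wpDl//.
  by rewrite ler_pM2l// lerDl.
split; first by apply/cvg_ex; exists L.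
by apply/cvg_lim.
Unshelve. all: by end_near. Qed.

(** Applied to the first partials of [H], whose continuity [C2_on] does not state but which follows
    from that of the second partials. *)
Lemma continuous_of_partials (g : 'rV[R]_K -> R) x :
  (\forall y \near x, forall i, derivable g y (basis_vec i)) ->
  (forall i, {for x, continuous (partial i g)}) -> {for x, continuous g}.
Proof.
move=> gd gc; have FF : Filter (nbhs x) by exact: nbhs_filter.
apply/cvgrPdistC_le => e e0.
pose S := \sum_(i < K) (`|partial i g x| + 1).
have S0 : 0 <= S by apply: sumr_ge0 => i _; rewrite addr_ge0.
have /nbhs_rowP[r r0 rP] : \forall y \near x, forall i,
    derivable g y (basis_vec i) /\ `|partial i g y - partial i g x| <= 1.
  near=> y => i; split; first by move: i; near: y.
  move: i; near: y; apply: filter_forall => i.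
  by have /cvgrPdistC_le := gc i; apply.
have r'0 : 0 < Num.min r (e / (S + 1)) by rewrite lt_min r0 divr_gt0// ltr_wpDl.
apply/nbhs_rowP; exists (Num.min r (e / (S + 1))) => // y yx.
have hr i : `|(y - x) 0 i| < r.
  by have := yx i; rewrite !mxE lt_min => /andP[].
have := @partial_mvt R K g x (y - x) r 1 (fun i => partial i g x) rP hr.
rewrite (addrC x) subrK mul1r => H1.
have H2 : `|\sum_(i < K) partial i g x * (y - x) 0 i| <=
  \sum_(i < K) `|partial i g x| * `|(y - x) 0 i|.
  by apply: (le_trans (ler_norm_sum _ _ _)); apply: ler_sum => i _; rewrite normrM.
have H3 : \sum_(i < K) `|partial i g x| * `|(y - x) 0 i| +
  \sum_(i < K) `|(y - x) 0 i| <= S * (e / (S + 1)).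
  rewrite -big_split/= mulr_suml; apply: ler_sum => i _.
  rewrite -[X in _ + X]mul1r -mulrDl ler_wpM2l ?addr_ge0//.
  by have := yx i; rewrite !mxE lt_min => /andP[_ /ltW].
have H4 : S * (e / (S + 1)) <= e.
  by rewrite mulrCA ler_piMr ?(ltW e0)// ler_pdivrMr ?ltr_wpDl// mul1r lerDl.
rewrite -[X in `|X|](subrK (\sum_(i < K) partial i g x * (y - x) 0 i)).
apply: (le_trans (ler_normD _ _)); apply: le_trans H4.
apply: (le_trans (lerD H1 H2)); rewrite addrC; exact: H3.
Unshelve. all: by end_near. Qed.

(* The mean value theorem is applied on the segment from [x] to [x + d], which
   avoids the symmetry of the second derivatives. *)
Lemma taylor2 (U : set 'rV[R]_K) (H : 'rV[R]_K -> R) x : C2_on U H -> U x ->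
  forall eps, 0 < eps -> exists2 r, 0 < r & forall d, (forall i, `|d 0 i| < r) ->
  `|H (x + d) - H x - \sum_(i < K) gradient H x 0 i * d 0 i
    - (d *m hessian H x *m d^T) 0 0 / 2| <= eps * (\sum_(i < K) `|d 0 i|) ^+ 2.
Proof.
move=> [oU dH ddH cH] Ux eps eps0.
have cpp y : U y -> forall i j, {for y, continuous (partial j (partial i H))}.
  move=> Uy i j; have := cH i j; rewrite continuous_open_subspace//.
  by apply; rewrite inE.
have nU y : U y -> \forall z \near y, U z by move=> Uy; exact: open_nbhs_nbhs.
have cp y : U y -> forall i, {for y, continuous (partial i H)}.
  move=> Uy i; apply: continuous_of_partials; last exact: cpp.
  by near=> z => j; apply: ddH; near: z; exact: nU.
have DH y v : U y -> derivable H y v /\ 'D_v H y = \sum_(i < K) partial i H y * v 0 i.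
  move=> Uy; apply: derive_of_partials; last exact: cp.
  by near=> z => j; apply: dH; near: z; exact: nU.
have /nbhs_rowP[r r0 rP] : \forall y \near x, U y /\ (forall i j,
     `|partial j (partial i H) y - hessian H x i j| <= eps).
  near=> y; split; first by near: y; exact: nU.
  near: y; apply: filter_forall => i; apply: filter_forall => j.
  by rewrite mxE; have /cvgrPdistC_le := cpp x Ux i j; apply.
exists r => // d dr; pose S := \sum_(i < K) `|d 0 i|.
have S0 : 0 <= S by exact: sumr_ge0.
pose b := \sum_(i < K) gradient H x 0 i * d 0 i.
pose q := (d *m hessian H x *m d^T) 0 0.
have qE : q = \sum_(i < K) (\sum_(j < K) hessian H x i j * d 0 j) * d 0 i.
  rewrite /q mxE.
  under eq_bigr => j _ do rewrite !mxE mulr_suml.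
  rewrite exchange_big/=; apply: eq_bigr => i _.
  by rewrite mulr_suml; apply: eq_bigr => j _; rewrite !mxE; ring.
have inU (s : R) : 0 <= s <= 1 -> forall i, `|(x + s *: d) 0 i - x 0 i| < r.
  move=> /andP[s0 s1] i; rewrite !mxE addrAC subrr add0r normrM ger0_norm//.
  by apply: le_lt_trans (dr i); rewrite ler_piMl.
pose D (s : R) := \sum_(i < K) partial i H (x + s *: d) * d 0 i.
(* [D s] is the derivative of [H] along the segment. Each first partial is compared with its
   linearisation by [partial_mvt], with a row of the Hessian as slopes. *)
have Dbound (s : R) : 0 <= s <= 1 -> `|D s - b - s * q| <= eps * S ^+ 2.
  move=> s01; have /andP[s0 s1] := s01.
  have -> : D s - b - s * q = \sum_(i < K) (partial i H (x + s *: d) - partial i H x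
      - \sum_(j < K) hessian H x i j * (s *: d) 0 j) * d 0 i.
    rewrite /D /b qE mulr_sumr -!sumrB; apply: eq_bigr => i _.
    rewrite !mulrBl mxE; congr (_ - _ - _).
    rewrite mulrA mulr_sumr; congr (_ * _).
    by apply: eq_bigr => j _; rewrite !mxE mulrCA.
  apply: (le_trans (ler_norm_sum _ _ _)).
  rewrite expr2 mulrA [leRHS]mulr_sumr; apply: ler_sum => i _.
  rewrite normrM ler_wpM2r//.
  apply: (le_trans (@partial_mvt R K (partial i H) x (s *: d) r eps
     (fun j => hessian H x i j) _ _)).
  - by move=> y /rP[Uy hy] j; split; [exact: ddH|exact: hy].
  - by move=> j; have := inU s s01 j; rewrite !mxE addrAC subrr add0r.
  rewrite ler_wpM2l ?(ltW eps0)//; apply: ler_sum => j _.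
  by rewrite mxE normrM ger0_norm// ler_piMl.
(* Subtracting the Taylor polynomial leaves a function whose derivative was just bounded, so a
   single mean value step on [[0, 1]] concludes. *)
pose psi (s : R) := H (x + s *: d) - (s * b + s ^+ 2 * (q / 2)).
have dpsi (s : R) : 0 <= s <= 1 -> is_derive s 1 psi (D s - b - s * q).
  move=> s01; have [Us _] := rP _ (inU s s01).
  have [dd De] := DH _ d Us.
  have h1 := derive_line dd; rewrite De -/(D s) in h1.
  apply: is_derive_eq.
  by rewrite /GRing.scale/=; field.
have cpsi : {within `[0, 1], continuous psi}.
  apply: derivable_within_continuous => s; rewrite in_itv/= => /dpsi hs.
  exact: ex_derive.
have [|c] := @MVT_segment R psi (fun s => D s - b - s * q) 0 1 ler01 _ cpsi.
  move=> s; rewrite in_itv/= => /andP[s0 s1]; apply: dpsi.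
  by rewrite !ltW.
rewrite in_itv/= => c01; rewrite subr0 mulr1 => E.
have -> : H (x + d) - H x - b - q / 2 = psi 1 - psi 0.
  by rewrite /psi scale1r scale0r addr0; ring.
by rewrite E; exact: Dbound.
Unshelve. all: by end_near. Qed.

End Differentiability.

(** * The quadratic bound on the simplex *)

Section QuadraticForms.
Context {R : realType} (K : nat).
Implicit Types (v d : 'rV[R]_K).

Lemma quad_formE (M : 'M[R]_K) d :
  (d *m M *m d^T) 0 0 = \sum_(i < K) \sum_(j < K) d 0 i * M i j * d 0 j.
Proof.
rewrite mxE exchange_big/=; apply: eq_bigr => j _.
by rewrite !mxE mulr_suml.
Qed.

Lemma quad_form_continuous (M : 'M[R]_K) :
  continuous (fun d => (d *m M *m d^T) 0 0).
Proof.
under eq_fun do rewrite quad_formE.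
move=> v; have FF : Filter (nbhs v) by exact: nbhs_filter.
apply: cvg_big => [|i _]; first exact: add_continuous.
apply: cvg_big => [|j _]; first exact: add_continuous.
apply: cvgM; last exact: coord_continuous.
by apply: cvgM; [exact: coord_continuous|exact: cvg_cst].
Qed.

Lemma sum_sqr_continuous (P : pred 'I_K) :
  continuous (fun d => \sum_(i < K | P i) d 0 i ^+ 2).
Proof.
move=> v; have FF : Filter (nbhs v) by exact: nbhs_filter.
apply: cvg_big => [|i _]; first exact: add_continuous.
by under eq_cvg do rewrite expr2; apply: cvgM; exact: coord_continuous.
Qed.

Lemma compact_sphere :
  compact [set d : 'rV[R]_K | \sum_(i < K) d 0 i = 0 /\ \sum_(i < K) d 0 i ^+ 2 = 1].
Proof.
apply: (subclosed_compact _
  (rV_compact (fun _ : 'I_K => @segment_compact R (-1) 1))).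
  rewrite (_ : mkset _ = (fun d => \sum_(i < K) d 0 i) @^-1` [set 0] `&`
    (fun d => \sum_(i < K) d 0 i ^+ 2) @^-1` [set 1]) //.
  apply: closedI; apply: preimage_closed; [|exact: closed_eq| |exact: closed_eq].
    by move=> x _; exact: sum_coord_continuous.
  by move=> x _; exact: sum_sqr_continuous.
move=> d [_ d1] i /=; rewrite in_itv/= -ler_norml.
rewrite -(@expr_le1 _ 2)// real_normK ?num_real// -d1 (bigD1 i)//= lerDl.
by apply: sumr_ge0 => j _; exact: sqr_ge0.
Qed.

(* Finsler's lemma: a form that is negative definite on the subspace [d_i = 0]
   becomes negative definite after subtracting a large multiple of [d_i ^+ 2]. *)
Lemma finsler (M : 'M[R]_K) (Z : pred 'I_K) :
  (forall d, d != 0 -> \sum_(i < K) d 0 i = 0 -> (forall i, Z i -> d 0 i = 0) ->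
     (d *m M *m d^T) 0 0 < 0) ->
  exists2 c, 0 < c & exists2 A, 0 <= A & forall d, \sum_(i < K) d 0 i = 0 ->
    (d *m M *m d^T) 0 0 / 2 <=
      - (c * \sum_(i < K) d 0 i ^+ 2) + A * \sum_(i < K | Z i) d 0 i ^+ 2.
Proof.
move=> Mneg.
pose q d := (d *m M *m d^T) 0 0.
pose z d := \sum_(i < K | Z i) d 0 i ^+ 2.
have z0 d : 0 <= z d by apply: sumr_ge0 => i _; exact: sqr_ge0.
(* One integer [N] controls both constants, [c = 1/(N+1)] and [A = N]; compactness of the tangential
   unit sphere makes it uniform. *)
have /compact_near_coveringP/near_covering_withinP := compact_sphere.
move=> /(_ nat \oo (fun N d => q d / 2 <= - N.+1%:R^-1 + N%:R * z d) _).
case=> [x [x0 x1]|N _ /(_ N (leqnn N)) HN].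
  have qc := @quad_form_continuous M x.
  have zc := @sum_sqr_continuous Z x.
  have FF : Filter (nbhs x) by exact: nbhs_filter.
  (* Where [z] vanishes the form is negative, and it remains so nearby. Elsewhere [z] is bounded
     below nearby, and [N * z] exceeds the form once [N] is large. *)
  have [zx0|zx0] := eqVneq (z x) 0.
    have qx : q x < 0.
      apply: Mneg => //.
        apply/eqP => x00; have := x1; rewrite x00.
        rewrite big1 => [/esym/eqP|i _]; first by rewrite oner_eq0.
        by rewrite mxE expr0n.
      move=> i Zi; have := zx0; rewrite /z => /eqP; rewrite psumr_eq0; last first.
        by move=> j _; exact: sqr_ge0.
      by move=> /allP/(_ i (mem_index_enum _)); rewrite Zi/= sqrf_eq0 => /eqP.
    near=> x' N => _.
    have h1 : q x' <= q x / 2.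
      near: x'; move/cvgr_le : qc; apply; rewrite /q -/(q x); lra.
    have h2 : N.+1%:R^-1 <= - q x / 4.
      near: N; have qx4 : 0 < - q x / 4 by lra.
      have [m _ hm] := near_infty_natSinv_lt (PosNum qx4).
      by exists m => // k mk; apply/ltW/hm.
    have h3 : 0 <= N%:R * z x' by rewrite mulr_ge0.
    have arith (a b c e : R) :
        a <= b / 2 -> c <= - b / 4 -> 0 <= e -> a / 2 <= - c + e by lra.
    exact: arith h1 h2 h3.
  have zx : 0 < z x by rewrite lt_neqAle eq_sym zx0 z0.
  near=> x' N => _.
  have h1 : q x' <= q x + 1.
    near: x'; move/cvgr_le : qc; apply; rewrite /q -/(q x); lra.
  have h2 : z x / 2 <= z x'.
    near: x'; move/cvgr_ge : zc; apply; rewrite /z -/(z x); lra.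
  (* Since [z x'] may be only half of [z x], the extra 2 is halved as well and then pays for
     [N.+1%:R^-1 <= 1]. *)
  have h3 : (q x + 1 + 2) / z x <= N%:R.
    by near: N; exact: nbhs_infty_ger.
  have h4 : q x + 1 + 2 <= N%:R * z x by rewrite -ler_pdivrMr.
  have h5 : N%:R * (z x / 2) <= N%:R * z x' by rewrite ler_wpM2l.
  have h6 : N.+1%:R^-1 <= 1 :> R by rewrite invf_le1 ?ler1n.
  have arith (a b c e f : R) :
      a <= b + 1 -> b + 1 + 2 <= e -> e / 2 <= f -> c <= 1 -> a / 2 <= - c + f.
    by lra.
  by apply: arith h1 h4 _ h6; rewrite -mulrA.
exists (N.+1%:R^-1); first by rewrite invr_gt0.
exists N%:R => // d d0.
pose s := \sum_(i < K) d 0 i ^+ 2.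
have s0 : 0 <= s by apply: sumr_ge0 => i _; exact: sqr_ge0.
have [se0|sne0] := eqVneq s 0.
  have -> : d = 0.
    apply/rowP => i; rewrite mxE; apply/eqP; rewrite -sqrf_eq0.
    move: se0 => /eqP; rewrite psumr_eq0; last by move=> j _; exact: sqr_ge0.
    by move=> /allP/(_ i (mem_index_enum _)).
  rewrite !mul0mx mxE mul0r big1 => [|i _]; last by rewrite mxE expr0n.
  by rewrite big1 => [|i _]; rewrite ?mxE ?expr0n// !mulr0 oppr0 addr0.
(* All terms are homogeneous of degree 2, so the bound extends from the sphere by normalising
   [d]. *)
pose r := Num.sqrt s.
have r0 : 0 < r by rewrite sqrtr_gt0 lt_neqAle eq_sym sne0.
have rs : r ^+ 2 = s by rewrite sqr_sqrtr.
have scal (P : pred 'I_K) : \sum_(i < K | P i) (r^-1 *: d) 0 i ^+ 2 =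
    s^-1 * \sum_(i < K | P i) d 0 i ^+ 2.
  by rewrite mulr_sumr; apply: eq_bigr => i _; rewrite mxE exprMn exprVn rs.
have /HN : \sum_(i < K) (r^-1 *: d) 0 i = 0 /\ \sum_(i < K) (r^-1 *: d) 0 i ^+ 2 = 1.
  split; last by rewrite scal mulVf.
  under eq_bigr do rewrite mxE.
  by rewrite -mulr_sumr d0 mulr0.
have -> : q (r^-1 *: d) = s^-1 * q d.
  rewrite /q !quad_formE mulr_sumr; apply: eq_bigr => i _.
  rewrite mulr_sumr; apply: eq_bigr => j _; rewrite !mxE -rs.
  by field; rewrite gt_eqF.
rewrite /z scal -/s -/(q d) => h.
have sp : 0 < s by rewrite lt_neqAle eq_sym sne0.
have := ler_wpM2l s0 h.
rewrite -mulrA mulVKf// mulrDr (mulrCA s N%:R) mulVKf// mulrN.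
by rewrite (mulrC s).
Unshelve. all: by end_near. Qed.

End QuadraticForms.

(** * From the KKT conditions to the bound by [gap] *)

Section Bound.
Context {R : realType} (K : nat).
Implicit Types (v d : 'rV[R]_K).

Lemma sqr_sum_le (a : 'I_K -> R) :
  (\sum_(i < K) a i) ^+ 2 <= K%:R * \sum_(i < K) a i ^+ 2.
Proof.
have -> : K%:R * \sum_(i < K) a i ^+ 2 =
    \sum_(i < K) \sum_(j < K) (a i ^+ 2 + a j ^+ 2) / 2.
  under [RHS]eq_bigr do rewrite -mulr_suml big_split/= sumr_const card_ord.
  rewrite -mulr_suml big_split/= sumr_const card_ord sumrMnl -mulr_natl.
  by field.
rewrite expr2 mulr_suml; apply: ler_sum => i _.
rewrite mulr_sumr; apply: ler_sum => j _.
have := sqr_ge0 (a i - a j); rewrite sqrrB => h.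
by rewrite ler_pdivlMr//; lra.
Qed.

(** The multiplier [mu] pairs with the coordinate sum of [d], which is zero; only the active
    constraints remain. *)
Lemma kkt_gradient (H : 'rV[R]_K -> R) (ths : 'rV[R]_K) (lam : 'I_K -> R) (mu : R) d :
  gradient H ths = - (\sum_(i in zero_idx ths) lam i *: basis_vec i)
    + mu *: const_mx 1 ->
  \sum_(i < K) d 0 i = 0 ->
  \sum_(i < K) gradient H ths 0 i * d 0 i =
    - \sum_(i in zero_idx ths) lam i * d 0 i.
Proof.
move=> -> d0.
under eq_bigr => i _.
  rewrite !mxE summxE mulr1 mulrDl mulNr.
  rewrite (_ : \sum_(j in _) _ = if i \in zero_idx ths then lam i else 0); last first.
    rewrite (eq_bigr (fun j => if j == i then lam i else 0)).
      rewrite -big_mkcondr/=; case: ifP => iZ.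
        by rewrite (big_pred1 i) // => j /=; case: eqVneq => [->|_]; rewrite ?iZ ?andbF.
      by rewrite big_pred0// => j; case: eqVneq => [->|_]; rewrite ?iZ ?andbF.
    move=> j _; rewrite !mxE eqxx/= eq_sym.
    by case: eqVneq => [->|_]; rewrite ?mulr1 ?mulr0.
  over.
rewrite big_split/= -mulr_sumr d0 mulr0 addr0 sumrN; congr (- _).
rewrite [RHS]big_mkcond/=; apply: eq_bigr => i _.
by case: ifP; rewrite ?mul0r.
Qed.

Variables (H : 'rV[R]_K -> R) (ths : 'rV[R]_K) (U : set 'rV[R]_K).
Variables (lam : 'I_K -> R) (mu : R).
Hypothesis sths : simplex ths.
Hypothesis Hmax : forall th, simplex th -> th != ths -> H th < H ths.
Hypothesis Hc : {within @simplex R K, continuous H}.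
Hypothesis HU : C2_on U H.
Hypothesis Uths : U ths.
Hypothesis kkt : gradient H ths =
  - (\sum_(i in zero_idx ths) lam i *: basis_vec i) + mu *: const_mx 1.
Hypothesis lam0 : forall i, ths 0 i = 0 -> 0 < lam i.
Hypothesis Hneg : forall d : 'rV[R]_K, d != 0 -> \sum_(i < K) d 0 i = 0 ->
  (forall i, ths 0 i = 0 -> d 0 i = 0) -> (d *m hessian H ths *m d^T) 0 0 < 0.

Definition gap v : R :=
  \sum_(i in zero_idx ths) v 0 i + \sum_(i < K) (v 0 i - ths 0 i) ^+ 2.

Lemma sum_simplexB v : simplex v -> \sum_(i < K) (v - ths) 0 i = 0.
Proof.
move=> [_ v1]; under eq_bigr do rewrite !mxE.
by rewrite sumrB v1; case: sths => _ ->; rewrite subrr.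
Qed.

Lemma gap_ge0 v : simplex v -> 0 <= gap v.
Proof.
move=> [v0 _]; apply: addr_ge0; first by apply: sumr_ge0.
by apply: sumr_ge0 => i _; exact: sqr_ge0.
Qed.

Lemma gap_le v : simplex v -> gap v <= K%:R + K%:R.
Proof.
have KE : K%:R = \sum_(i < K) 1 :> R by rewrite sumr_const card_ord.
move=> sv; rewrite {1 2}KE; apply: lerD.
  rewrite big_mkcond/=; apply: ler_sum => i _; case: ifP => // _.
  exact: simplex_le1.
apply: ler_sum => i _; have [v0 _] := sv; have [t0 _] := sths.
have := v0 i; have := t0 i; have := simplex_le1 i sv; have := simplex_le1 i sths.
by move=> *; nra.
Qed.

(** Finsler's lemma leaves a positive term [A * d_i ^+ 2] for [i] in Z. Close to [ths] it is at most
    half of the linear decrease [lam i * d_i], since there [d_i = v_i >= 0] is small. The Taylor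
    remainder uses up half of the quadratic decrease. *)
Lemma local_quadratic_bound : exists2 c, 0 < c & exists2 r, 0 < r &
  forall v, simplex v -> (forall i, `|v 0 i - ths 0 i| < r) ->
    H v - H ths <= - (c * gap v).
Proof.
have [c0 c00 [A A0 fin]] := @finsler R K (hessian H ths)
  (fun i => i \in zero_idx ths) ltac:(move=> d d1 d2 d3; apply: Hneg => // i hi;
    apply: d3; rewrite inE hi eqxx; by []).
(* The default value 1 keeps [l] positive when Z is empty; only [l <= lam i] on Z is used. *)
pose l := \big[Num.min/1]_(i in zero_idx ths) lam i.
have l0 : 0 < l.
  rewrite /l; elim/big_ind : _ => // [a b a0 b0|i]; first by rewrite lt_min a0.
  by rewrite inE => /eqP; exact: lam0.
have ll i : i \in zero_idx ths -> l <= lam i by move=> iZ; exact: bigmin_le_cond.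
(* Chosen so that [eps * K%:R <= c0 / 2], the factor [K] coming from [sqr_sum_le]. *)
pose eps := c0 / (2 * (K%:R + 1)).
have K1 : 0 < 2 * (K%:R + 1) :> R by rewrite mulr_gt0// ltr_wpDl.
have eps0 : 0 < eps by rewrite divr_gt0.
have [r r0 rP] := taylor2 HU Uths eps0.
pose c := Num.min (l / 2) (c0 / 2).
exists c; first by rewrite lt_min !divr_gt0.
have A1 : 0 < 2 * A + 1 by rewrite ltr_wpDl// mulr_ge0.
(* The second radius gives [A * v_i <= l / 2] on Z. *)
exists (Num.min r (l / (2 * A + 1))); first by rewrite lt_min r0 divr_gt0.
move=> v sv vr; pose d := v - ths.
have dE i : d 0 i = v 0 i - ths 0 i by rewrite !mxE.
have d0 := sum_simplexB sv; rewrite -/d in d0.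
have /rP : forall i, `|d 0 i| < r.
  by move=> i; rewrite dE; have := vr i; rewrite lt_min => /andP[].
rewrite (kkt_gradient kkt d0) /d (addrC ths) subrK -/d => T.
have dS : (\sum_(i < K) `|d 0 i|) ^+ 2 <= K%:R * \sum_(i < K) d 0 i ^+ 2.
  apply: (le_trans (sqr_sum_le _)); rewrite ler_wpM2l//; apply: ler_sum => i _.
  by rewrite real_normK// num_real.
have dZ i : i \in zero_idx ths -> d 0 i = v 0 i.
  by rewrite inE dE => /eqP ->; rewrite subr0.
have v0 := sv.1.
pose s := \sum_(i < K) d 0 i ^+ 2.
pose z := \sum_(i in zero_idx ths) v 0 i.
have s0 : 0 <= s by apply: sumr_ge0 => i _; exact: sqr_ge0.
have z0 : 0 <= z by apply: sumr_ge0.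
have gE : gap v = z + s.
  by rewrite /gap; congr (_ + _); apply: eq_bigr => i _; rewrite dE.
have h1 : l * z <= \sum_(i in zero_idx ths) lam i * d 0 i.
  rewrite mulr_sumr; apply: ler_sum => i iZ; rewrite dZ// ler_wpM2r//; exact: ll.
have h2 : A * \sum_(i in zero_idx ths) d 0 i ^+ 2 <= (l / 2) * z.
  rewrite !mulr_sumr; apply: ler_sum => i iZ; rewrite dZ// expr2 mulrA ler_wpM2r//.
  have := vr i; rewrite -dE dZ// lt_min => /andP[_].
  rewrite ger0_norm// => /ltW vl.
  apply: (le_trans (ler_wpM2l A0 vl)); rewrite mulrA ler_pdivrMr//.
  by nra.
have h3 : eps * (\sum_(i < K) `|d 0 i|) ^+ 2 <= c0 / 2 * s.
  apply: (le_trans (ler_wpM2l (ltW eps0) dS)); rewrite mulrA ler_wpM2r//.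
  rewrite /eps mulrAC ler_pdivrMr//.
  rewrite (_ : c0 / 2 * (2 * (K%:R + 1)) = c0 * (K%:R + 1)); last by field.
  by rewrite ler_pM2l// lerDl.
have h4 : c * z <= l / 2 * z by rewrite ler_wpM2r// ge_min lexx.
have h5 : c * s <= c0 / 2 * s by rewrite ler_wpM2r// ge_min lexx orbT.
have := fin _ d0; rewrite -/s => h6.
have /ler_normlW := T; rewrite -/(d) => h7.
have arith (G hv ht B Q E z' s' : R) : hv - ht - - G - Q <= E -> l * z' <= G ->
  Q <= - (c0 * s') + A * B -> A * B <= l / 2 * z' -> E <= c0 / 2 * s' ->
  c * z' <= l / 2 * z' -> c * s' <= c0 / 2 * s' -> hv - ht <= - (c * (z' + s')).
  rewrite -!mulrA !(mulrCA _ 2^-1) mulrDr; move: (l * z') (c0 * s') (A * B) (c * z') (c * s').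
  by move=> *; lra.
rewrite gE; exact: arith h7 h1 h6 h2 h3 h4 h5.
Qed.

(** At points other than [ths], [H] stays below [H ths] by a fixed amount on a neighbourhood, while
    [gap] is at most [2K], so a small enough constant works. Compactness reduces all these constants
    to one [1/(N+1)]. *)
Lemma quadratic_bound : exists2 c, 0 < c & forall v, simplex v ->
  H v - H ths <= - (c * gap v).
Proof.
have /compact_near_coveringP/near_covering_withinP := @compact_simplex R K.
move=> /(_ nat \oo (fun N v => H v - H ths <= - (N.+1%:R^-1 * gap v)) _).
case=> [x sx|N _ /(_ N (leqnn N)) HN]; last first.
  by exists N.+1%:R^-1 => //; rewrite invr_gt0.
have FF : Filter (nbhs x) by exact: nbhs_filter.
have [->|xt] := eqVneq x ths.
  have [c c0 [r r0 rP]] := local_quadratic_bound.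
  near=> x' N => sx'.
  have h1 : H x' - H ths <= - (c * gap x').
    apply: rP => //; near: x'; apply/nbhs_rowP; by exists r.
  have h2 : N.+1%:R^-1 <= c.
    near: N; have [m _ hm] := near_infty_natSinv_lt (PosNum c0).
    by exists m => // k mk; apply/ltW/hm.
  by apply: (le_trans h1); rewrite lerN2 ler_wpM2r// gap_ge0.
have Hx := Hmax sx xt.
have h : H @ within (@simplex R K) (nbhs x) --> H x.
  by move/subspace_continuousP : Hc; apply.
near=> x' N => sx'.
have /(_ sx') h1 : simplex x' -> H x' <= H x + (H ths - H x) / 2.
  near: x'.
  by move/cvgr_le : h; apply; lra.
have h2 : (2 * (K%:R + K%:R)) / (H ths - H x) <= N%:R.
  by near: N; exact: nbhs_infty_ger.
have Hp : 0 < H ths - H x by rewrite subr_gt0.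
rewrite ler_pdivrMr// in h2.
have h3 : N.+1%:R^-1 * gap x' <= (H ths - H x) / 2.
  rewrite mulrC ler_pdivrMr ?ltr0n//; apply: (le_trans (gap_le sx')).
  have h4 : N%:R * (H ths - H x) <= N.+1%:R * (H ths - H x).
    by rewrite ler_pM2r// ler_nat.
  have arith (a b e : R) : 2 * a <= b -> b <= e -> a <= e / 2 by lra.
  by rewrite mulrAC (mulrC _ N.+1%:R); exact: arith h2 h4.
have arith (a b e f : R) : a <= b + (e - b) / 2 -> f <= (e - b) / 2 -> a - e <= - f.
  by lra.
exact: arith h1 h3.
Unshelve. all: by end_near. Qed.

End Bound.

(** * The Dirichlet normalisation *)

Section OneDim.
Context {R : realType}.
Notation mu := (@lebesgue_measure R).

(** This is [y <= expR y] at [y = c * x / p], raised to the power [p]. It yields the integrability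
    of the Gamma densities and later lets the exponential of the far region beat a power of [n]. *)
Lemma expR_powR_bound (p c x : R) : 0 < p -> 0 < c -> 0 <= x ->
  x `^ p * expR (- (c * x)) <= (p / c) `^ p.
Proof.
move=> p0 c0 x0; have p0' := ltW p0; have c0' := ltW c0.
have h : (c * x / p) `^ p <= expR (c * x).
  rewrite [c * x in leRHS](_ : _ = c * x / p * p); last by field; rewrite gt_eqF.
  rewrite expRM; apply: ge0_ler_powR; rewrite ?nnegrE ?expR_ge0//.
    by rewrite divr_ge0// mulr_ge0.
  by apply: le_trans (expR_ge1Dx _); rewrite lerDr.
rewrite expRN ler_pdivrMr ?expR_gt0//.
rewrite (_ : x = (p / c) * (c * x / p)); last by field; rewrite !gt_eqF.
rewrite powRM ?divr_ge0 ?mulr_ge0// ler_wpM2l ?powR_ge0//.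
rewrite (_ : p / c * (c * x / p) = x) //; last by field; rewrite !gt_eqF.
Qed.

Definition gamma_fun (a c x : R) : R :=
  if 0 <= x then x `^ (a - 1) * expR (- (c * x)) else 0.

Lemma gamma_fun_ge0 (a c x : R) : 0 <= gamma_fun a c x.
Proof. by rewrite /gamma_fun; case: ifP => // _; rewrite mulr_ge0 ?powR_ge0 ?expR_ge0. Qed.

Lemma measurable_gamma_fun (a c : R) : measurable_fun setT (gamma_fun a c).
Proof.
apply: measurable_fun_ifT => //; first exact: measurable_fun_ler.
apply: measurable_funM; first exact: measurable_powR.
by apply: measurableT_comp => //; apply: measurableT_comp => //; exact: measurable_funM.
Qed.

(* Up to a constant, [gamma_fun a c] is below the derivative [phi a] of the
   bounded function [Phi a]. *)
Let phi (a x : R) := a * x `^ (a - 1) / (1 + x `^ a) ^+ 2.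
Let Phi (a x : R) := - (1 + x `^ a)^-1.

Let dPhi (a x : R) : 0 < x -> is_derive x 1 (Phi a) (phi a x).
Proof.
move=> x0; rewrite /Phi.
have h := is_derive1_powR a x0.
have nz : 1 + x `^ a != 0 by rewrite gt_eqF// ltr_pwDl// powR_ge0.
pose g : R -> R := fun x => 1 + x `^ a.
have hg : is_derive x 1 g (a * x `^ (a - 1)).
  have := is_deriveD (is_derive_cst (1 : R) x 1) h.
  by rewrite add0r.
have hN := is_deriveN (@is_deriveV R g x _ 1 nz hg).
apply: (is_derive_eq hN); rewrite /phi /GRing.scale/=.
by rewrite mulNr opprK mulrC.
Qed.

Let cphi (a x : R) : 0 < x -> {for x, continuous (phi a)}.
Proof.
move=> x0; have cp (b : R) : {for x, continuous (@powR R ^~ b)}.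
  apply: differentiable_continuous; apply/derivable1_diffP.
  by have [] := is_derive1_powR b x0.
rewrite /phi; apply: cvgM.
  by apply: cvgM; [exact: cvg_cst|exact: cp].
apply: cvgV; first by rewrite expf_neq0// gt_eqF// ltr_pwDl// powR_ge0.
rewrite expr2; under eq_cvg do rewrite expr2.
by apply: cvgM; apply: cvgD; [exact: cvg_cst|exact: cp|exact: cvg_cst|exact: cp].
Qed.

Let phi_ge0 (a x : R) : 0 < a -> 0 <= phi a x.
Proof. by move=> a0; rewrite divr_ge0 ?exprn_ge0 ?addr_ge0 ?mulr_ge0 ?powR_ge0// ltW. Qed.

Let mphi (a : R) : measurable_fun setT (phi a).
Proof.
rewrite (_ : phi a = fun x => a * x `^ (a - 1) * ((1 + x `^ a) ^+ 2) `^ (-1)).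
  apply: measurable_funM.
    by apply: measurable_funM => //; exact: measurable_powR.
  apply: (measurableT_comp (measurable_powR _)).
  by apply: measurable_funX; apply: measurable_funD => //; exact: measurable_powR.
by apply/funext => x; rewrite powR_inv1// exprn_ge0// addr_ge0// powR_ge0.
Qed.

(** The antiderivative [Phi a] takes values between -1 and 0, hence the bound 1 on every compact
    interval. *)
Let int_phi (a e b : R) : 0 < a -> 0 < e -> e < b ->
  (\int[mu]_(x in `[e, b]) (phi a x)%:E <= 1%:E)%E.
Proof.
move=> a0 e0 eb; have b0 := lt_trans e0 eb.
have pos x : x \in `[e, b] -> 0 < x.
  by rewrite in_itv/= => /andP[ex _]; exact: lt_le_trans ex.
have cont x : x \in `[e, b] -> {for x, continuous (Phi a)}.
  move=> /pos x0; apply: differentiable_continuous; apply/derivable1_diffP.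
  by have [] := dPhi a x0.
rewrite (@continuous_FTC2 _ _ (Phi a))//.
- rewrite -EFinB lee_fin /Phi opprK.
  have h1 : (1 + e `^ a)^-1 <= 1 by rewrite invf_le1 ?lerDl ?ltr_pwDl ?powR_ge0.
  have h2 : 0 <= (1 + b `^ a)^-1 by rewrite invr_ge0 addr_ge0 ?powR_ge0.
  by lra.
- by apply: continuous_in_subspaceT => x /set_mem /pos; exact: cphi.
- split.
  + move=> x xeb; have x0 : 0 < x by apply: pos; exact: subset_itv_oo_cc xeb.
    by have [] := dPhi a x0.
  + by apply: cvg_at_right_filter; apply: cont; rewrite in_itv/= lexx ltW.
  + by apply: cvg_at_left_filter; apply: cont; rewrite in_itv/= lexx ltW.
- move=> x xeb; have x0 : 0 < x by apply: pos; exact: subset_itv_oo_cc xeb.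
  by have [_] := dPhi a x0; rewrite derive1E.
Qed.

Let int_phi_pos (a : R) : 0 < a ->
  (\int[mu]_(x in `]0%R, +oo[) (phi a x)%:E <= 1%:E)%E.
Proof.
move=> a0.
(* With [n.+2] the endpoints are strictly ordered already at [n = 0], as [int_phi] requires. *)
pose F (n : nat) : set R := `[n.+2%:R^-1, n.+2%:R]%classic.
have UF : `]0%R, +oo[%classic = \bigcup_n F n.
  apply/seteqP; split => x; rewrite /F/=; last first.
    move=> [n _ /=]; rewrite !in_itv/= andbT => /andP[+ _]; apply: lt_le_trans.
    by rewrite invr_gt0.
  rewrite in_itv/= andbT => x0.
  have xV0 : 0 < x^-1 by rewrite invr_gt0.
  pose n := Num.truncn (x + x^-1).
  exists n => //=; rewrite in_itv/=.
  have : x + x^-1 < n.+1%:R by rewrite /n truncnS_gt.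
  have : n.+1%:R <= n.+2%:R :> R by rewrite ler_nat.
  move=> h1 h2; apply/andP; split; last by lra.
  by rewrite -[x]invrK lef_pV2 ?posrE ?ltr0n//; lra.
have ndF : {homo F : n m / (n <= m)%N >-> (n <= m)%O}.
  move=> n m nm; apply/subsetPset => x; rewrite /F/= !in_itv/= => /andP[h1 h2].
  apply/andP; split; last by rewrite (le_trans h2)// ler_nat !ltnS.
  by apply: le_trans h1; rewrite lef_pV2 ?posrE ?ltr0n// ler_nat !ltnS.
have H : (\int[mu]_(x in F i) (phi a x)%:E @[i --> \oo] -->
    \int[mu]_(x in \bigcup_i F i) (phi a x)%:E)%E.
  apply: ge0_nondecreasing_set_cvg_integral => //.
  - by move=> i; exact: measurable_itv.
  - by move=> i; apply/measurable_EFinP; apply: measurable_funTS; exact: mphi.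
  - by move=> i x _; rewrite lee_fin phi_ge0.
rewrite UF -(cvg_lim _ H)//; apply: lime_le.
  by apply/cvg_ex; eexists; exact: H.
apply: nearW => n; apply: int_phi; rewrite ?invr_gt0//.
by rewrite (@lt_trans _ _ 1)// ?ltr1n// invf_lt1 ?ltr1n.
Qed.

Lemma gamma_fun_lty (a c : R) : 0 < a -> 0 < c ->
  (\int[mu]_x (gamma_fun a c x)%:E < +oo)%E.
Proof.
move=> a0 c0; have a20 : 0 < a * 2 by rewrite mulr_gt0.
(* With [y = x^a], one has [(1 + y)^2 <= 2 + 2 y^2]; the exponential is at most 1 on the first term
   and [expR_powR_bound] with exponent [2a] bounds the second. The division by [a] cancels the
   factor [a] of [phi]. *)
pose C := (2 + 2 * (a * 2 / c) `^ (a * 2)) / a.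
have C0 : 0 <= C by rewrite divr_ge0 ?(ltW a0)// addr_ge0// mulr_ge0// powR_ge0.
have bnd x : 0 < x -> gamma_fun a c x <= C * phi a x.
  move=> x0; rewrite /gamma_fun (ltW x0) /C /phi.
  set y := x `^ a; set e := expR _; set p := x `^ (a - 1).
  have y0 : 0 <= y by exact: powR_ge0.
  have p0 : 0 <= p by exact: powR_ge0.
  have e0 : 0 < e by exact: expR_gt0.
  have e1 : e <= 1 by rewrite /e expR_le1 oppr_le0 mulr_ge0// ltW.
  have h : y ^+ 2 * e <= (a * 2 / c) `^ (a * 2).
    have -> : y ^+ 2 = x `^ (a * 2) by rewrite powRrM powR_mulrn.
    by apply: expR_powR_bound => //; exact: ltW.
  rewrite mulrA ler_pdivlMr ?exprn_gt0 ?ltr_pwDl//.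
  rewrite (mulrA _ a) divfK ?gt_eqF//.
  rewrite (_ : p * e * _ = (1 + y) ^+ 2 * e * p); last by ring.
  rewrite ler_wpM2r//.
  have hy := sqr_ge0 (1 - y).
  have h2 : (1 + y) ^+ 2 * e <= (2 + 2 * y ^+ 2) * e.
    by rewrite ler_wpM2r ?(ltW e0)//; nra.
  by move: h; set w := y ^+ 2 * e; move: h2; rewrite mulrDl -(mulrA 2) -/w; lra.
have -> : (\int[mu]_x (gamma_fun a c x)%:E =
    \int[mu]_(x in `]0%R, +oo[) (gamma_fun a c x)%:E)%E.
  rewrite integral_itv_obnd_cbnd; last first.
    by apply/measurable_EFinP; apply: measurable_funTS; exact: measurable_gamma_fun.
  rewrite [RHS]integral_mkcond; apply: eq_integral => x _.
  rewrite patchE; case: ifPn => //; rewrite notin_setE/= in_itv/= andbT => /negP x0.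
  by rewrite /gamma_fun (negbTE x0).
apply: (@le_lt_trans _ _ (C%:E * \int[mu]_(x in `]0%R, +oo[) (phi a x)%:E)%E); last first.
  by rewrite lte_mul_pinfty// (le_lt_trans (int_phi_pos a0))// ltry.
rewrite -ge0_integralZl_EFin//; last 2 first.
- by move=> x _; rewrite lee_fin phi_ge0.
- by apply/measurable_EFinP; apply: measurable_funTS; exact: mphi.
apply: ge0_le_integral => //.
- by move=> x _; rewrite lee_fin gamma_fun_ge0.
- by apply/measurable_EFinP; apply: measurable_funTS; exact: measurable_gamma_fun.
- by apply/measurable_EFinP; apply: measurable_funTS; apply: measurable_funM => //; exact: mphi.
- by move=> x /=; rewrite in_itv/= andbT => x0; rewrite -EFinM lee_fin bnd.
Qed.

Definition gauss_fun_scaled (c x : R) : R := expR (- (c * x ^+ 2)).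

Lemma measurable_gauss_fun_scaled c : measurable_fun setT (gauss_fun_scaled c).
Proof.
apply: measurableT_comp => //; apply: measurableT_comp => //.
by apply: measurable_funM => //; exact: measurable_funX.
Qed.

Lemma gauss_fun_scaled_lty c : 0 < c ->
  (\int[mu]_x (gauss_fun_scaled c x)%:E < +oo)%E.
Proof.
move=> c0; pose b := (Num.sqrt c)^-1.
have b0 : 0 < b by rewrite invr_gt0 sqrtr_gt0.
rewrite (@ge0_integral_affine _ 0 b) ?gt_eqF//; last 2 first.
- by apply/measurable_EFinP; exact: measurable_gauss_fun_scaled.
- by move=> x; rewrite lee_fin expR_ge0.
rewrite [X in (_ * X)%E](_ : _ = (Num.sqrt pi)%:E) -?EFinM ?ltry//.
rewrite -integralT_gauss; apply: eq_integral => x _.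
rewrite /gauss_fun_scaled /gauss_fun add0r exprMn exprVn.
by rewrite sqr_sqrtr ?(ltW c0)// mulVKf// gt_eqF.
Qed.

End OneDim.

(** * The integrand, and charts omitting one coordinate *)

Section Weight.
Context {R : realType} (K : nat).
Variables (alpha : 'I_K -> R) (H : 'rV[R]_K -> R) (h0 : R).
Hypothesis Hc : {within @simplex R K, continuous H}.

(* [weight simplex 0] is the unnormalised Dirichlet density. *)
Definition weight (S : set 'rV[R]_K) (n : R) (v : 'rV[R]_K) : R :=
  if `[< S v >] then \prod_(i < K) v 0 i `^ (alpha i - 1) * expR (n * (H v - h0))
  else 0.

Lemma weight_ge0 S n v : 0 <= weight S n v.
Proof.
rewrite /weight; case: ifP => // _; rewrite mulr_ge0 ?expR_ge0// prodr_ge0// => i _.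
exact: powR_ge0.
Qed.

(** The conditional is treated branch by branch, because the measurability of [H] is available only
    on the preimage of a closed part of the simplex. *)
Lemma measurable_weight d (T : measurableType d) (X : T -> 'rV[R]_K)
    (S : set 'rV[R]_K) n :
  (forall i, measurable_fun setT (fun t => X t 0 i)) ->
  closed S -> S `<=` @simplex R K ->
  measurable_fun setT (fun t => weight S n (X t)).
Proof.
move=> mX cS SS.
have mS : measurable (X @^-1` S) by exact: measurable_preimage_closed.
have mb : measurable_fun setT (fun t => `[< S (X t) >]).
  apply: (measurable_fun_bool true); rewrite setTI.
  rewrite (_ : _ @^-1` _ = X @^-1` S)//.
  by apply/seteqP; split => t /= /asboolP.
apply: measurable_fun_if => //.
apply: measurable_funM.
  apply: measurable_prod => i _; apply: measurable_funTS.
  by apply: (measurableT_comp (measurable_powR _)); exact: mX.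
apply: measurableT_comp => //; apply: measurable_funM => //.
apply: measurable_funB => //.
rewrite setTI (_ : _ @^-1` _ = X @^-1` S); last first.
  by apply/seteqP; split => t /= /asboolP.
apply: measurable_fun_within => //.
exact: continuous_subspaceW SS Hc.
Qed.

End Weight.

Section Points.
Context {R : realType} (N : nat).
Implicit Types (t : N.-tuple R) (k : 'I_N.+1).

(* [chart k] parametrises the simplex by the coordinates other than [k]: the
   [j]-th parameter is the coordinate of index [free_idx k j]. *)
Definition chart k t : 'rV[R]_N.+1 :=
  col_perm (tperm k ord_max) (@complete_pt R N.+1 t).

Definition free_idx k (j : 'I_N) : 'I_N.+1 := tperm k ord_max (lift ord_max j).

Lemma chart_free_idx k t j : chart k t 0 (free_idx k j) = tnth t j.
Proof. by rewrite /chart mxE complete_ptE tpermK liftK. Qed.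

Lemma chart_last k t : chart k t 0 k = 1 - \sum_(j < N) tnth t j.
Proof. by rewrite /chart mxE complete_ptE tpermL unlift_none. Qed.

Lemma free_idx_neq k j : free_idx k j != k.
Proof.
apply/eqP => /(congr1 (tperm k ord_max)); rewrite tpermK tpermL => /eqP.
by rewrite eq_sym (negbTE (neq_lift _ _)).
Qed.

Lemma free_idxP k i : i != k -> exists j, i = free_idx k j.
Proof.
move=> ik; case: (unliftP ord_max (tperm k ord_max i)) => [j E|E].
  by exists j; rewrite /free_idx -E tpermK.
by move: ik; rewrite -[i](tpermK k ord_max) E tpermR eqxx.
Qed.

Lemma big_free_idx (T : Type) (idx : T) (op : Monoid.com_law idx) k (F : 'I_N.+1 -> T) :
  \big[op/idx]_(i < N.+1) F i = op (F k) (\big[op/idx]_(j < N) F (free_idx k j)).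
Proof.
rewrite (reindex_inj (@perm_inj _ (tperm k ord_max))) (bigD1_ord ord_max)//=.
by rewrite tpermR.
Qed.

Lemma measurable_chart k i : measurable_fun setT (fun t => chart k t 0 i).
Proof.
have [->|/free_idxP[j ->]] := eqVneq i k.
  under eq_fun do rewrite chart_last.
  apply: measurable_funB => //; apply: measurable_sum => j; exact: measurable_tnth.
by under eq_fun do rewrite chart_free_idx; exact: measurable_tnth.
Qed.

Lemma chart_ord_max t : chart ord_max t = @complete_pt R N.+1 t.
Proof. by rewrite /chart tperm1 col_perm1. Qed.

(** Exchanging coordinate [k] with the completed one is exactly the reflection in the parameter [k],
    which preserves the integral. *)
Lemma leb_int_chart k (F : 'rV[R]_N.+1 -> \bar R) :
  measurable_fun setT (fun t => F (@complete_pt R N.+1 t)) ->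
  (forall v, (0 <= F v)%E) ->
  leb_int (fun t => F (@complete_pt R N.+1 t)) =
  leb_int (fun t => F (chart k t)).
Proof.
move=> mF F0; case: (unliftP ord_max k) => [j ->|->]; last first.
  by rewrite /chart; under [in RHS]eq_fun do rewrite tperm1 col_perm1.
rewrite (leb_int_reflect j)//; congr leb_int; apply/funext => t /=; congr F.
apply/rowP => i; rewrite /chart [RHS]mxE !complete_ptE.
case: (unliftP ord_max i) => [i' ->|->]; last first.
  rewrite tpermR liftK (bigD1 j)//= tnth_mktuple eqxx.
  have -> : (\sum_(l < N | l != j) tnth (reflect_tuple j t) l =
      \sum_(l < N | l != j) tnth t l)%R.
    by apply: eq_bigr => l /negbTE lj; rewrite tnth_mktuple lj.
  by rewrite (bigD1 j)//=; ring.
rewrite tnth_mktuple; case: eqVneq => [->|ij].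
  by rewrite tpermL unlift_none.
rewrite tpermD ?liftK//; last exact: neq_lift.
by rewrite (inj_eq lift_inj) eq_sym.
Qed.

Lemma measurable_complete_pt i :
  measurable_fun setT (fun t : N.-tuple R => @complete_pt R N.+1 t 0 i).
Proof. by under eq_fun do rewrite -chart_ord_max; exact: measurable_chart. Qed.

Lemma chart_sum k t : \sum_(i < N.+1) chart k t 0 i = 1.
Proof.
rewrite (big_free_idx _ k) chart_last.
have -> : \sum_(j < N) chart k t 0 (free_idx k j) = \sum_(j < N) tnth t j.
  by apply: eq_bigr => j _; rewrite chart_free_idx.
exact: subrK.
Qed.

End Points.

(** The sum covers both signs of [b]: the power is at most 1 for [b >= 0] and at most the power of
    [l] for [b < 0]. *)
Lemma powR_le_bound {R : realType} (l v b : R) : 0 < l -> l <= v -> v <= 1 ->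
  v `^ b <= 1 + l `^ b.
Proof.
move=> l0 lv v1; have v0 : 0 < v := lt_le_trans l0 lv.
have [b0|b0] := leP 0 b.
  apply: (@le_trans _ _ 1); last by rewrite lerDl powR_ge0.
  have -> : 1 = 1 `^ b :> R by rewrite powR1.
  by apply: ge0_ler_powR => //; rewrite nnegrE// ltW.
apply: (@le_trans _ _ (l `^ b)); last by rewrite lerDr.
rewrite -[b]opprK !(powRN _ (- b)) lef_pV2 ?posrE ?powR_gt0//.
apply: ge0_ler_powR => //; rewrite ?nnegrE ?oppr_ge0; exact: ltW.
Qed.

Section ProdBound.
Context {R : realType}.
Notation mu := (@lebesgue_measure R).

Lemma measurable_prod_tnth n (g : 'I_n -> R -> R) (c : R) :
  (forall i, measurable_fun setT (g i)) ->
  measurable_fun setT (fun t : n.-tuple R => (c * \prod_(i < n) g i (tnth t i))%:E).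
Proof.
move=> mg; apply/measurable_EFinP; apply: measurable_funM => //.
apply: measurable_prod => i _.
by apply: (measurableT_comp (mg i)); exact: measurable_tnth.
Qed.

Lemma leb_int_prod_lty n (g : 'I_n -> R -> R) (c : R) :
  (forall i, measurable_fun setT (g i)) -> (forall i x, 0 <= g i x) ->
  (forall i, (\int[mu]_x (g i x)%:E < +oo)%E) -> 0 <= c ->
  (leb_int (fun t : n.-tuple R => (c * \prod_(i < n) g i (tnth t i))%:E) < +oo)%E.
Proof.
move=> mg g0 gi c0; under eq_fun do rewrite EFinM.
rewrite leb_intZl//; last 2 first.
- have := measurable_prod_tnth 1 mg.
  by under eq_fun do rewrite mul1r.
- by move=> t; rewrite lee_fin prodr_ge0.
rewrite leb_int_prod//.
by rewrite -(fineK (prod_integral_fin_num g0 gi)) -EFinM ltry.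
Qed.

End ProdBound.

Section Norm.
Context {R : realType} (N : nat).
Variables (alpha : 'I_N.+1 -> R) (H : 'rV[R]_N.+1 -> R) (h0 : R).
Hypothesis Hc : {within @simplex R N.+1, continuous H}.
Hypothesis alpha0 : forall i, 0 < alpha i.
Notation K := N.+1.
Notation W := (weight alpha H h0).

Lemma closed_coord_ge (i : 'I_K) (a : R) : closed [set v : 'rV[R]_K | a <= v 0 i].
Proof.
apply: (@preimage_closed _ _ (fun v : 'rV[R]_K => v 0 i) [set x | a <= x]).
  by move=> x _; exact: coord_continuous.
exact: closed_ge.
Qed.

(* On [S k] the factor of index [k] is bounded, and the [S k] cover the simplex. *)
Let S k : set 'rV[R]_K := simplex `&` [set v | K%:R^-1 <= v 0 k].

(** At [n = 0] the exponential is 1, so this is the finiteness of B(alpha). On [S k] the chart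
    omitting [k] leaves only integrable one-variable factors. *)
Lemma weight_norm_lty :
  (leb_int (fun t : N.-tuple R => (W simplex 0 (@complete_pt R K t))%:E) < +oo)%E.
Proof.
have cS k : closed (S k) by apply: closedI; [exact: closed_simplex|exact: closed_coord_ge].
have SS k : S k `<=` simplex by move=> v [].
have mW A k : closed A -> A `<=` simplex ->
    measurable_fun setT (fun t : N.-tuple R => (W A 0 (chart k t))%:E).
  move=> cA AS; apply/measurable_EFinP; apply: measurable_weight => // i.
  exact: measurable_chart.
have mWc A : closed A -> A `<=` simplex ->
    measurable_fun setT (fun t : N.-tuple R => (W A 0 (@complete_pt R K t))%:E).
  by move=> cA AS; under eq_fun do rewrite -chart_ord_max; exact: mW.
have W0 A v : (0 <= (W A 0 v)%:E)%E by rewrite lee_fin weight_ge0.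
apply: (@le_lt_trans _ _ (\sum_(k < K)
    leb_int (fun t : N.-tuple R => (W (S k) 0 (@complete_pt R K t))%:E))%E).
  rewrite -leb_int_sum//; last by move=> k; exact: mWc.
  apply: le_leb_int => //.
  - by apply: mWc => //; exact: closed_simplex.
  - by apply: emeasurable_sum => k; exact: mWc.
  move=> t; rewrite sumEFin lee_fin; move: (@complete_pt R K t) => v.
  have [sv|sv] := pselect (simplex v); last first.
    rewrite {1}/weight asboolF//; apply: sumr_ge0 => k _; exact: weight_ge0.
  (* Coordinates all below [1/K] could not sum to 1. *)
  have [k vk] : exists k, K%:R^-1 <= v 0 k.
    apply: contrapT => /forallNP nk; have [_] := sv; apply/eqP; rewrite lt_eqF//.
    apply: (@lt_le_trans _ _ (\sum_(i < K) K%:R^-1)).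
      apply: ltr_sum => [|i _]; first by apply/hasP; exists ord0; rewrite ?mem_index_enum.
      by rewrite ltNge; exact/negP/nk.
    by rewrite sumr_const card_ord -(mulr_natl K%:R^-1) divff.
  rewrite (bigD1 k)//= (_ : W simplex 0 v = W (S k) 0 v).
    by rewrite lerDl; apply: sumr_ge0 => i _; exact: weight_ge0.
  by rewrite /weight !asboolT.
apply: lte_sum_pinfty => k _.
rewrite (leb_int_chart (F := fun v => (W (S k) 0 v)%:E) k)//; last exact: mWc.
pose g j := gamma_fun (alpha (free_idx k j)) 1.
(* The power of [expR 1] compensates the exponentials in the Gamma densities, each at least
   [expR (-1)] on [[0, 1]]. *)
pose M := (1 + K%:R^-1 `^ (alpha k - 1)) * expR 1 ^+ N.
have M0 : 0 <= M by rewrite mulr_ge0 ?addr_ge0 ?powR_ge0 ?exprn_ge0 ?expR_ge0.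
have mg j : measurable_fun setT (g j) by exact: measurable_gamma_fun.
apply: (@le_lt_trans _ _ (leb_int (fun t : N.-tuple R =>
    (M * \prod_(j < N) g j (tnth t j))%:E))); last first.
  apply: leb_int_prod_lty => // [j x|j]; first exact: gamma_fun_ge0.
  exact: gamma_fun_lty.
apply: le_leb_int => //; first exact: mW.
  exact: measurable_prod_tnth.
move=> t; rewrite lee_fin /weight; case: asboolP => [[[v0 v1] vk]|_]; last first.
  by rewrite mulr_ge0// prodr_ge0// => j _; exact: gamma_fun_ge0.
have sv : simplex (chart k t) by [].
rewrite mul0r expR0 mulr1 (big_free_idx _ k) /M -mulrA; apply: ler_pM.
- exact: powR_ge0.
- by apply: prodr_ge0 => j _; exact: powR_ge0.
- by apply: powR_le_bound; [rewrite invr_gt0 ltr0n|exact: vk|exact: simplex_le1].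
- have -> : expR 1 ^+ N = \prod_(j < N) expR 1 :> R.
    by rewrite prodr_const card_ord.
  rewrite -big_split/=.
  apply: ler_prod => j _; rewrite powR_ge0/= chart_free_idx.
  have tj : 0 <= tnth t j by rewrite -(chart_free_idx k); exact: v0.
  rewrite /g /gamma_fun tj mulrCA ler_peMr ?powR_ge0// -expRD mul1r.
  apply: le_trans (expR_ge1Dx _); rewrite lerDl subr_ge0 -(chart_free_idx k).
  exact: simplex_le1.
Qed.

Lemma weight_norm_gt0 :
  (0 < leb_int (fun t : N.-tuple R => (W simplex 0 (@complete_pt R K t))%:E))%E.
Proof.
(* On this cube the [N = K - 1] free coordinates sum to less than 1, so the point is interior to the
   simplex. *)
apply: (@leb_int_gt0 _ _ _ 0 K%:R^-1); first by rewrite invr_gt0.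
- apply/measurable_EFinP; apply: measurable_weight => //; last exact: closed_simplex.
  exact: measurable_complete_pt.
- by move=> t; rewrite lee_fin weight_ge0.
move=> t ht; rewrite lte_fin -chart_ord_max.
have vpos i : 0 < chart ord_max t 0 i.
  have [->|/free_idxP[j ->]] := eqVneq i ord_max; last by rewrite chart_free_idx; case/andP: (ht j).
  rewrite chart_last subr_gt0 (@le_lt_trans _ _ (\sum_(j < N) K%:R^-1))//.
    by apply: ler_sum => j _; case/andP: (ht j) => _ /ltW.
  by rewrite sumr_const card_ord -(mulr_natl K%:R^-1) ltr_pdivrMr// mul1r ltr_nat.
rewrite /weight asboolT; last by split; [move=> i; exact: ltW|exact: chart_sum].
by rewrite mulr_gt0 ?expR_gt0// prodr_gt0// => i _; exact: powR_gt0.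
Qed.

End Norm.

(** * Rescaling at the maximiser *)

Section LocalLimit.
Context {R : realType} (K : nat).

Lemma cvg_row (w : nat -> 'rV[R]_K) (y : 'rV[R]_K) :
  (forall i, w m 0 i @[m --> \oo] --> y 0 i) -> w @ \oo --> y.
Proof.
move=> h P /nbhs_rowP[r r0 rP].
suff : \forall m \near \oo, forall i, `|w m 0 i - y 0 i| < r.
  by apply: filterS => m; exact: rP.
by apply: filter_forall => i; have /cvgrPdistC_lt := h i; apply.
Qed.

Variables (H : 'rV[R]_K -> R) (ths : 'rV[R]_K) (U : set 'rV[R]_K).
Variables (lam : 'I_K -> R) (mu : R).
Hypothesis HU : C2_on U H.
Hypothesis Uths : U ths.
Hypothesis kkt : gradient H ths =
  - (\sum_(i in zero_idx ths) lam i *: basis_vec i) + mu *: const_mx 1.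

(** On Z the direction is itself of order [s], so the linear KKT term and the Hessian term both
    scale as [s ^+ 2]. The Taylor remainder is an arbitrarily small multiple of [s ^+ 2], as the
    directions stay bounded. *)
Lemma local_limit (s : nat -> R) (w : nat -> 'rV[R]_K) (x : 'I_K -> R) (y : 'rV[R]_K) :
  (forall m, 0 < s m) -> s m @[m --> \oo] --> 0 ->
  w @ \oo --> y -> (forall m, \sum_(i < K) w m 0 i = 0) ->
  (forall m i, i \in zero_idx ths -> w m 0 i = s m * x i) ->
  s m ^- 2 * (H (ths + s m *: w m) - H ths) @[m --> \oo] -->
  - \sum_(i in zero_idx ths) lam i * x i + (y *m hessian H ths *m y^T) 0 0 / 2.
Proof.
move=> s0 sc wy w0 wZ.
pose q (d : 'rV[R]_K) := (d *m hessian H ths *m d^T) 0 0.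
have qc : q (w m) @[m --> \oo] --> q y.
  by apply: (cvg_comp w q wy); exact: quad_form_continuous.
have wi i : w m 0 i @[m --> \oo] --> y 0 i.
  exact: (cvg_comp w (fun v : 'rV[R]_K => v 0 i) wy (@coord_continuous _ _ _ 0 i y)).
pose S (v : 'rV[R]_K) := \sum_(i < K) `|v 0 i|.
have Sc : S (w m) @[m --> \oo] --> S y.
  apply: cvg_big => [|i _]; first exact: add_continuous.
  by apply: cvg_norm.
have S0 v : 0 <= S v by exact: sumr_ge0.
apply/cvgrPdistC_le => e e0.
(* Eventual bound for [S (w m) ^+ 2]; it fixes the precision asked of the Taylor expansion. *)
pose B := (S y + 1) ^+ 2.
have B0 : 0 < B by rewrite exprn_gt0// ltr_wpDl.
have e20 : 0 < e / 2 by rewrite divr_gt0.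
have eB0 : 0 < e / 2 / B by rewrite divr_gt0.
have [r r0 rP] := taylor2 HU Uths eB0.
near=> m.
have h1 : `|q (w m) - q y| <= e.
  by near: m; move/cvgrPdistC_le : qc; apply.
have h2 : S (w m) <= S y + 1.
  by near: m; move/cvgr_le : Sc; apply; rewrite ltrDl.
have h3 i : `|(s m *: w m) 0 i| < r.
  rewrite mxE normrM (gtr0_norm (s0 m)).
  apply: (@le_lt_trans _ _ (s m * (S y + 1))).
    rewrite ler_wpM2l ?(ltW (s0 m))//; apply: le_trans h2.
    by rewrite /S (bigD1 i)//= lerDl sumr_ge0.
  rewrite -ltr_pdivlMr ?ltr_wpDl//.
  near: m; move/cvgr_lt : sc; apply; by rewrite divr_gt0// ltr_wpDl.
have := rP _ h3.
have d0 : \sum_(i < K) (s m *: w m) 0 i = 0.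
  by under eq_bigr do rewrite mxE; rewrite -mulr_sumr w0 mulr0.
rewrite (kkt_gradient kkt d0).
have -> : \sum_(i in zero_idx ths) lam i * (s m *: w m) 0 i =
    s m ^+ 2 * \sum_(i in zero_idx ths) lam i * x i.
  rewrite mulr_sumr; apply: eq_bigr => i iZ; rewrite mxE wZ//; ring.
have -> : (s m *: w m *m hessian H ths *m (s m *: w m)^T) 0 0 = s m ^+ 2 * q (w m).
  rewrite /q !quad_formE mulr_sumr; apply: eq_bigr => i _.
  by rewrite mulr_sumr; apply: eq_bigr => j _; rewrite !mxE; ring.
have -> : \sum_(i < K) `|(s m *: w m) 0 i| = s m * S (w m).
  rewrite mulr_sumr; apply: eq_bigr => i _.
  by rewrite mxE normrM (gtr0_norm (s0 m)).
set L := \sum_(i in _) _; set D := H _ - H _ => T.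
have s20 : 0 < s m ^+ 2 by rewrite exprn_gt0.
have T2 : `|s m ^- 2 * D + L - q (w m) / 2| <= e / 2.
  rewrite -(ler_pM2l s20) -{1}(gtr0_norm s20) -normrM.
  have -> : s m ^+ 2 * (s m ^- 2 * D + L - q (w m) / 2) =
     D - - (s m ^+ 2 * L) - s m ^+ 2 * q (w m) / 2.
    by field; rewrite gt_eqF.
  apply: (le_trans T); rewrite exprMn mulrCA ler_pM2l//.
  rewrite -[leRHS](@divfK _ B) ?gt_eqF// ler_wpM2l ?(ltW eB0)//.
  rewrite /B ler_sqr ?nnegrE// addr_ge0//.
have -> : s m ^- 2 * D - (- L + (y *m hessian H ths *m y^T) 0 0 / 2) =
  (s m ^- 2 * D + L - q (w m) / 2) + (q (w m) - q y) / 2.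
  by rewrite -/(q y); field; rewrite gt_eqF.
apply: (le_trans (ler_normD _ _)).
rewrite normrM [`|2^-1|]ger0_norm//.
have h4 : `|q (w m) - q y| / 2 <= e / 2 by rewrite ler_wpM2r.
by rewrite [leRHS](splitr e) lerD.
Unshelve. all: by end_near. Qed.

End LocalLimit.

(** * The rescaled integrand and its majorant *)

Section Scaling.
Context {R : realType} (N : nat).
Notation K := N.+1.
Notation mu := (@lebesgue_measure R).
Variables (alpha : 'I_K -> R) (H : 'rV[R]_K -> R) (ths : 'rV[R]_K) (c : R) (k : 'I_K).
Hypothesis alpha0 : forall i, 0 < alpha i.
Hypothesis sths : simplex ths.
Hypothesis Hc : {within @simplex R K, continuous H}.
Hypothesis c0 : 0 < c.
Hypothesis Hgap : forall v, simplex v -> H v - H ths <= - (c * gap ths v).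
Hypothesis kZ : k \notin zero_idx ths.

Notation Z := (zero_idx ths).
Notation W := (weight alpha H (H ths)).

(** Non-strict inequalities keep the set closed, as [measurable_weight] requires. *)
Definition near_simplex : set 'rV[R]_K :=
  simplex `&` \bigcap_(i in [set i | i \notin Z]) [set v | ths 0 i / 2 <= v 0 i].

Lemma closed_near_simplex : closed near_simplex.
Proof.
apply: closedI; first exact: closed_simplex.
by apply: closed_bigI => i _; exact: closed_coord_ge.
Qed.

Lemma near_simplex_sub : near_simplex `<=` simplex.
Proof. by move=> v []. Qed.

Lemma ths_gt0 i : i \notin Z -> 0 < ths 0 i.
Proof. by rewrite inE => iZ; rewrite lt_neqAle eq_sym iZ; case: sths => ->. Qed.

Lemma ths_eq0 i : i \in Z -> ths 0 i = 0.
Proof. by rewrite inE => /eqP. Qed.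

Lemma sum_free_idx_ths : \sum_(j < N) ths 0 (free_idx k j) = 1 - ths 0 k.
Proof. by have [_ <-] := sths; rewrite (big_free_idx _ k)/= addrAC subrr add0r. Qed.

Definition scale_fac (s : R) (i : 'I_K) : R := if i \in Z then s ^+ 2 else s.

Definition scaled_tuple (s : R) (x : N.-tuple R) : N.-tuple R :=
  affine_tuple (fun j => ths 0 (free_idx k j)) (fun j => scale_fac s (free_idx k j)) x.

Definition scaled_pt (s : R) (x : N.-tuple R) : 'rV[R]_K := chart k (scaled_tuple s x).

(* [scaled_pt s x = ths + s *: direction s x], and [direction 0 x] is the
   tangential part of [x]. *)
Definition direction (s : R) (x : N.-tuple R) : 'rV[R]_K :=
  chart k [tuple if free_idx k j \in Z then s * tnth x j else tnth x j | j < N]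
  - basis_vec k.

Lemma scaled_pt_free_idx s x j :
  scaled_pt s x 0 (free_idx k j) = ths 0 (free_idx k j) + scale_fac s (free_idx k j) * tnth x j.
Proof. by rewrite /scaled_pt chart_free_idx tnth_mktuple. Qed.

Lemma direction_free_idx s x j : direction s x 0 (free_idx k j) =
  if free_idx k j \in Z then s * tnth x j else tnth x j.
Proof.
by rewrite mxE chart_free_idx tnth_mktuple !mxE (negbTE (free_idx_neq _ _)) andbF subr0.
Qed.

Lemma direction_k s x : direction s x 0 k = - \sum_(j < N) direction s x 0 (free_idx k j).
Proof.
under [in RHS]eq_bigr do rewrite direction_free_idx.
rewrite mxE chart_last !mxE !eqxx/= addrAC subrr add0r; congr (- _).
by apply: eq_bigr => j _; rewrite tnth_mktuple.
Qed.

Lemma direction_sum s x : \sum_(i < K) direction s x 0 i = 0.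
Proof. by rewrite (big_free_idx _ k)/= direction_k addNr. Qed.

Lemma scaled_ptE s x : scaled_pt s x = ths + s *: direction s x.
Proof.
have E j : scaled_pt s x 0 (free_idx k j) = (ths + s *: direction s x) 0 (free_idx k j).
  rewrite scaled_pt_free_idx /scale_fac 2!mxE direction_free_idx; congr (_ + _).
  by case: ifP => // _; rewrite expr2 mulrA.
apply/rowP => i; have [->|/free_idxP[j ->]] := eqVneq i k; last exact: E.
rewrite chart_last.
under eq_bigr => j _ do rewrite -(chart_free_idx k) -/(scaled_pt s x) E 2!mxE.
rewrite big_split/= sum_free_idx_ths -mulr_sumr 2!mxE direction_k mulrN.
by rewrite opprD opprB addrA addrC addrCA; ring.
Qed.

(** Cancels the powers of [s ^+ 2] that the factors with index in Z produce under the rescaling. *)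
Definition scale_inv (s : R) : R :=
  \prod_(j < N) (if free_idx k j \in Z then (s ^+ 2) `^ (- (alpha (free_idx k j) - 1)) else 1).

Definition scaled_weight (s : R) (x : N.-tuple R) : R :=
  scale_inv s * W near_simplex (s ^- 2) (scaled_pt s x).

Lemma scale_inv_ge0 s : 0 <= scale_inv s.
Proof. by apply: prodr_ge0 => j _; case: ifP => // _; exact: powR_ge0. Qed.

Lemma scaled_weight_ge0 s x : 0 <= scaled_weight s x.
Proof. by rewrite mulr_ge0 ?scale_inv_ge0 ?weight_ge0. Qed.

Lemma measurable_scaled_pt s i : measurable_fun setT (fun x => scaled_pt s x 0 i).
Proof.
have [->|/free_idxP[j ->]] := eqVneq i k.
  under eq_fun do rewrite chart_last.
  apply: measurable_funB => //; apply: measurable_sum => j.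
  under eq_fun do rewrite tnth_mktuple.
  apply: measurable_funD => //; apply: measurable_funM => //.
  exact: measurable_tnth.
under eq_fun do rewrite scaled_pt_free_idx.
apply: measurable_funD => //; apply: measurable_funM => //.
exact: measurable_tnth.
Qed.

Lemma measurable_scaled_weight s : measurable_fun setT (scaled_weight s).
Proof.
apply: measurable_funM => //; apply: measurable_weight => //.
- exact: measurable_scaled_pt.
- exact: closed_near_simplex.
- exact: near_simplex_sub.
Qed.

Lemma near_simplex_coord_ge0 s x j : 0 < s -> near_simplex (scaled_pt s x) ->
  free_idx k j \in Z -> 0 <= tnth x j.
Proof.
move=> s0 [[v0 _] _] jZ; have := v0 (free_idx k j).
by rewrite scaled_pt_free_idx ths_eq0// add0r /scale_fac jZ pmulr_rge0// exprn_gt0.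
Qed.

Lemma scaled_weightE s x : 0 < s -> near_simplex (scaled_pt s x) ->
  scaled_weight s x = scaled_pt s x 0 k `^ (alpha k - 1) *
    (\prod_(j < N) (if free_idx k j \in Z then tnth x j `^ (alpha (free_idx k j) - 1)
       else scaled_pt s x 0 (free_idx k j) `^ (alpha (free_idx k j) - 1))) *
    expR (s ^- 2 * (H (scaled_pt s x) - H ths)).
Proof.
move=> s0 sx; rewrite /scaled_weight /weight asboolT// mulrA; congr (_ * _).
rewrite (big_free_idx _ k)/= mulrCA; congr (_ * _).
rewrite /scale_inv -big_split/=; apply: eq_bigr => j _.
case: ifP => jZ; last by rewrite mul1r.
have xj := near_simplex_coord_ge0 s0 sx jZ.
rewrite scaled_pt_free_idx ths_eq0// add0r /scale_fac jZ powRM ?sqr_ge0//.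
rewrite mulrA powRN mulVf ?mul1r// gt_eqF// powR_gt0// exprn_gt0//.
Qed.

Definition majorant_coord (j : 'I_N) : R -> R :=
  if free_idx k j \in Z then gamma_fun (alpha (free_idx k j)) c else gauss_fun_scaled c.

(** Collects the bounds of [powR_le_bound] for the indices outside Z, whose coordinates are at least
    [ths_i / 2] on [near_simplex]. *)
Definition majorant_cst : R := (1 + (ths 0 k / 2) `^ (alpha k - 1)) *
  \prod_(j < N) (if free_idx k j \in Z then 1
                 else 1 + (ths 0 (free_idx k j) / 2) `^ (alpha (free_idx k j) - 1)).

Lemma majorant_cst_ge0 : 0 <= majorant_cst.
Proof.
rewrite mulr_ge0 ?addr_ge0 ?powR_ge0// prodr_ge0// => j _.
by case: ifP; rewrite ?addr_ge0 ?powR_ge0.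
Qed.

Lemma majorant_coord_ge0 j x : 0 <= majorant_coord j x.
Proof.
by rewrite /majorant_coord; case: ifP => _; [exact: gamma_fun_ge0|exact: expR_ge0].
Qed.

Lemma measurable_majorant_coord j : measurable_fun setT (majorant_coord j).
Proof.
rewrite /majorant_coord; case: ifP => _; first exact: measurable_gamma_fun.
exact: measurable_gauss_fun_scaled.
Qed.

Lemma majorant_coord_lty j : (\int[mu]_x (majorant_coord j x)%:E < +oo)%E.
Proof.
rewrite /majorant_coord; case: ifP => _; first exact: gamma_fun_lty.
exact: gauss_fun_scaled_lty.
Qed.

(** The squares over Z and the square of coordinate [k] are dropped, leaving a sum of functions of
    one free variable each. *)
Lemma gap_scaled_ge s x : 0 < s ->
  \sum_(j < N) (if free_idx k j \in Z then tnth x j else tnth x j ^+ 2) <=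
  s ^- 2 * gap ths (scaled_pt s x).
Proof.
move=> s0; rewrite /gap mulrDr.
have s20 : s ^+ 2 != 0 by rewrite gt_eqF// exprn_gt0.
rewrite [\sum_(i in Z) _]big_mkcond/= !(big_free_idx _ k)/= (negbTE kZ) add0r mulrDr addrCA.
apply: ler_wpDl; first by rewrite mulr_ge0 ?invr_ge0 ?sqr_ge0.
rewrite !mulr_sumr -big_split/=; apply: ler_sum => j _.
rewrite scaled_pt_free_idx /scale_fac; case: ifP => jZ.
  rewrite ths_eq0// add0r subr0 mulKf// lerDl mulr_ge0 ?invr_ge0 ?sqr_ge0//.
by rewrite mulr0 add0r addrAC subrr add0r exprMn mulKf.
Qed.

Lemma scaled_weight_le s x : 0 < s ->
  scaled_weight s x <= majorant_cst * \prod_(j < N) majorant_coord j (tnth x j).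
Proof.
move=> s0; have [sx|sx] := pselect (near_simplex (scaled_pt s x)); last first.
  rewrite /scaled_weight /weight asboolF// mulr0 mulr_ge0 ?majorant_cst_ge0//.
  by apply: prodr_ge0 => j _; exact: majorant_coord_ge0.
rewrite scaled_weightE// /majorant_cst -!mulrA.
have [ss nb] := sx.
have up i : i \notin Z -> scaled_pt s x 0 i `^ (alpha i - 1) <=
    1 + (ths 0 i / 2) `^ (alpha i - 1).
  move=> iZ; apply: powR_le_bound; first by rewrite divr_gt0// ths_gt0.
  - exact: nb.
  - exact: simplex_le1.
apply: ler_pM.
- exact: powR_ge0.
- rewrite mulr_ge0 ?expR_ge0// prodr_ge0// => j _.
  by case: ifP => _; exact: powR_ge0.
- exact: up.
(* The exponential now splits over the free variables: each factor joins a power of [x_j] to form a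
   Gamma density, or a bounded power to form a Gaussian. *)
have hexp : expR (s ^- 2 * (H (scaled_pt s x) - H ths)) <=
    \prod_(j < N) expR (- (c * (if free_idx k j \in Z then tnth x j else tnth x j ^+ 2))).
  rewrite -expR_sum ler_expR sumrN -mulr_sumr.
  apply: (@le_trans _ _ (- (c * (s ^- 2 * gap ths (scaled_pt s x))))).
    rewrite (mulrCA c) -mulrN ler_wpM2l ?invr_ge0 ?sqr_ge0//; exact: Hgap.
  by rewrite lerN2 ler_wpM2l ?(ltW c0)// gap_scaled_ge.
rewrite -big_split/=.
apply: (@le_trans _ _ ((\prod_(j < N) (if free_idx k j \in Z
    then tnth x j `^ (alpha (free_idx k j) - 1)
    else scaled_pt s x 0 (free_idx k j) `^ (alpha (free_idx k j) - 1))) *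
  \prod_(j < N) expR (- (c * (if free_idx k j \in Z then tnth x j else tnth x j ^+ 2))))).
  by rewrite ler_wpM2l// prodr_ge0// => j _; case: ifP => _; exact: powR_ge0.
rewrite -big_split/=; apply: ler_prod => j _; apply/andP; split.
  by rewrite mulr_ge0 ?expR_ge0//; case: ifP => _; exact: powR_ge0.
rewrite /majorant_coord; case: ifPn => jZ.
  by rewrite mul1r /gamma_fun (near_simplex_coord_ge0 s0 sx jZ).
by rewrite /gauss_fun_scaled ler_wpM2r ?expR_ge0// up.
Qed.

End Scaling.

(** * The limit integrand and its integral *)

Section Limit.
Context {R : realType} (N : nat).
Notation K := N.+1.
Variables (alpha : 'I_K -> R) (H : 'rV[R]_K -> R) (ths : 'rV[R]_K) (k : 'I_K).
Variables (U : set 'rV[R]_K) (lam : 'I_K -> R) (mu : R).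
Hypothesis sths : simplex ths.
Hypothesis kZ : k \notin zero_idx ths.
Hypothesis HU : C2_on U H.
Hypothesis Uths : U ths.
Hypothesis kkt : gradient H ths =
  - (\sum_(i in zero_idx ths) lam i *: basis_vec i) + mu *: const_mx 1.

Notation Z := (zero_idx ths).

(** For [i] in Z, [chart k x 0 i] just reads the free variable of index [i], because [k] is outside
    Z. *)
Definition limit_exponent (x : N.-tuple R) : R :=
  - \sum_(i in Z) lam i * chart k x 0 i +
  (direction ths k 0 x *m hessian H ths *m (direction ths k 0 x)^T) 0 0 / 2.

(** In the limit the variables of Z range over half-lines and the others over whole lines; the
    omitted coordinate imposes no constraint. *)
Definition limit_weight (x : N.-tuple R) : R :=
  if [forall j, (free_idx k j \in Z) ==> (0 <= tnth x j)] then
    ths 0 k `^ (alpha k - 1) *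
    (\prod_(j < N) (if free_idx k j \in Z then tnth x j `^ (alpha (free_idx k j) - 1)
       else ths 0 (free_idx k j) `^ (alpha (free_idx k j) - 1))) * expR (limit_exponent x)
  else 0.

Lemma cvg_powR_base (v : nat -> R) (a b : R) : 0 < a -> v m @[m --> \oo] --> a ->
  v m `^ b @[m --> \oo] --> a `^ b.
Proof.
move=> a0 va; have cp : {for a, continuous (@powR R ^~ b)}.
  apply: differentiable_continuous; apply/derivable1_diffP.
  by have [] := is_derive1_powR b a0.
exact: (cvg_comp v (@powR R ^~ b) va cp).
Qed.

Lemma scaled_weight_cvg (s : nat -> R) (x : N.-tuple R) :
  (forall m, 0 < s m) -> s m @[m --> \oo] --> 0 ->
  scaled_weight alpha H ths k (s m) x @[m --> \oo] --> limit_weight x.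
Proof.
move=> s0 sc; rewrite /limit_weight; case: ifPn => [/forallP xZ|]; last first.
  rewrite negb_forall => /existsP[j]; rewrite negb_imply -ltNge => /andP[jZ xj].
  rewrite [X in X @ _ --> _](_ : _ = cst 0); first exact: cvg_cst.
  apply/funext => m; rewrite /scaled_weight /weight asboolF ?mulr0// => nv.
  (* A negative variable in Z puts every rescaled point outside the simplex, so the sequence is
     constantly 0. *)
  by have := near_simplex_coord_ge0 (s0 m) nv jZ; rewrite leNgt xj.
have dc : direction ths k (s m) x @[m --> \oo] --> direction ths k 0 x.
  apply: cvg_row => i.
  have csig j : direction ths k (s m) x 0 (free_idx k j) @[m --> \oo] -->
      direction ths k 0 x 0 (free_idx k j).
    under eq_cvg do rewrite direction_free_idx.
    rewrite direction_free_idx; case: ifP => _; last exact: cvg_cst.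
    by apply: cvgM => //; exact: cvg_cst.
  have [->|/free_idxP[j ->]] := eqVneq i k; last exact: csig.
  under eq_cvg do rewrite direction_k.
  rewrite direction_k; apply: cvgN.
  by apply: cvg_big => [|j _]; [exact: add_continuous|exact: csig].
have vc i : scaled_pt ths k (s m) x 0 i @[m --> \oo] --> ths 0 i.
  under eq_cvg do rewrite scaled_ptE// 2!mxE.
  have di : direction ths k (s m) x 0 i @[m --> \oo] --> direction ths k 0 x 0 i.
    by apply: (cvg_comp _ (fun v : 'rV[R]_K => v 0 i) dc); exact: coord_continuous.
  have := cvgD (cvg_cst (ths 0 i)) (cvgM sc di).
  by rewrite mul0r addr0; exact.
(* Coordinates in Z equal [s m ^+ 2 * x_j >= 0] at every stage; the others tend to
   [ths_i > ths_i / 2]. *)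
have nv : \forall m \near \oo, near_simplex ths (scaled_pt ths k (s m) x).
  have h : \forall m \near \oo, forall i, i \notin Z ->
      ths 0 i / 2 <= scaled_pt ths k (s m) x 0 i.
    apply: filter_forall => i; have [iZ|iZ] := boolP (i \in Z); first exact: nearW.
    have t0 := ths_gt0 sths iZ.
    have : \forall m \near \oo, ths 0 i / 2 <= scaled_pt ths k (s m) x 0 i.
      by move/cvgr_ge : (vc i); apply; rewrite ltr_pdivrMr// ltr_pMr// ltr1n.
    by apply: filterS.
  apply: filterS h => m h; split; last by move=> i iZ; exact: h.
  split; last exact: chart_sum.
  move=> i; have [iZ|iZ] := boolP (i \in Z); last first.
    by apply: le_trans (h _ iZ); rewrite divr_ge0// ltW// ths_gt0.
  have /free_idxP[j ij] : i != k by apply: contraNneq kZ => <-.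
  rewrite ij in iZ *; rewrite scaled_pt_free_idx ths_eq0// add0r /scale_fac iZ.
  by rewrite mulr_ge0 ?sqr_ge0//; have := xZ j; rewrite iZ.
apply: (@cvg_trans _ ((scaled_pt ths k (s m) x 0 k `^ (alpha k - 1) *
    (\prod_(j < N) (if free_idx k j \in Z then tnth x j `^ (alpha (free_idx k j) - 1)
       else scaled_pt ths k (s m) x 0 (free_idx k j) `^ (alpha (free_idx k j) - 1))) *
    expR ((s m) ^- 2 * (H (scaled_pt ths k (s m) x) - H ths))) @[m --> \oo])).
  apply: near_eq_cvg; apply: filterS nv => m nv.
  by rewrite scaled_weightE.
apply: cvgM; [apply: cvgM|].
- by apply: cvg_powR_base; [exact: ths_gt0|exact: vc].
- apply: cvg_big => [|j _]; first exact: mul_continuous.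
  case: ifPn => jZ; first exact: cvg_cst.
  by apply: cvg_powR_base; [exact: ths_gt0|exact: vc].
apply: (cvg_comp _ expR); last exact: continuous_expR.
under eq_cvg do rewrite scaled_ptE//.
apply: (local_limit HU Uths kkt (x := fun i => chart k x 0 i)) => //.
  by move=> m; exact: direction_sum.
move=> m i iZ; have /free_idxP[j ij] : i != k by apply: contraNneq kZ => <-.
by rewrite ij in iZ *; rewrite direction_free_idx iZ chart_free_idx.
Qed.

Lemma limit_weight_gt0 x : (forall j, 0 < tnth x j) -> 0 < limit_weight x.
Proof.
move=> x0; rewrite /limit_weight ifT; last first.
  by apply/forallP => j; apply/implyP => _; exact: ltW.
rewrite mulr_gt0 ?expR_gt0// mulr_gt0 ?powR_gt0 ?ths_gt0//.
apply: prodr_gt0 => j _; case: ifPn => jZ; apply: powR_gt0 => //.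
exact: ths_gt0.
Qed.

Lemma limit_weight_ge0 x : 0 <= limit_weight x.
Proof.
rewrite /limit_weight; case: ifP => // _.
rewrite !mulr_ge0 ?expR_ge0 ?powR_ge0// prodr_ge0// => j _.
by case: ifP => _; exact: powR_ge0.
Qed.

Variable c : R.
Hypothesis alpha0 : forall i, 0 < alpha i.
Hypothesis Hc : {within @simplex R K, continuous H}.
Hypothesis c0 : 0 < c.
Hypothesis Hgap : forall v, simplex v -> H v - H ths <= - (c * gap ths v).

Lemma leb_int_scaled_weight_lty s : 0 < s ->
  (leb_int (fun x => (scaled_weight alpha H ths k s x)%:E) < +oo)%E.
Proof.
move=> s0; apply: (@le_lt_trans _ _ (leb_int (fun x : N.-tuple R =>
  (majorant_cst alpha ths k *
     \prod_(j < N) majorant_coord alpha ths c k j (tnth x j))%:E))); last first.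
  apply: leb_int_prod_lty.
  - by move=> j; exact: measurable_majorant_coord.
  - by move=> j y; exact: majorant_coord_ge0.
  - by move=> j; exact: majorant_coord_lty.
  - exact: majorant_cst_ge0.
apply: le_leb_int.
- by apply/measurable_EFinP; exact: measurable_scaled_weight.
- by apply: measurable_prod_tnth => j; exact: measurable_majorant_coord.
- by move=> x; rewrite lee_fin scaled_weight_ge0.
- by move=> x; rewrite lee_fin scaled_weight_le.
Qed.

Lemma leb_int_scaled_weight_cvg (s : nat -> R) :
  (forall m, 0 < s m) -> s m @[m --> \oo] --> 0 ->
  leb_int (fun x => (scaled_weight alpha H ths k (s m) x)%:E) @[m --> \oo] -->
  leb_int (fun x => (limit_weight x)%:E).
Proof.
move=> s0 sc; apply: (leb_int_dominated_cvg
  (g := majorant_coord alpha ths c k) (c := majorant_cst alpha ths k)).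
- by move=> m; apply/measurable_EFinP; exact: measurable_scaled_weight.
- by move=> m x; rewrite lee_fin scaled_weight_ge0.
- move=> x; apply: cvg_EFin; first exact: nearW.
  exact: scaled_weight_cvg.
- by move=> j; exact: measurable_majorant_coord.
- by move=> j y; exact: majorant_coord_ge0.
- by move=> j; exact: majorant_coord_lty.
- exact: majorant_cst_ge0.
- by move=> m x; rewrite lee_fin scaled_weight_le.
Qed.

Lemma leb_int_limit_weight_gt0 : (0 < leb_int (fun x => (limit_weight x)%:E))%E.
Proof.
pose s (m : nat) : R := m.+1%:R^-1.
have s0 m : 0 < s m by rewrite invr_gt0.
have sc : s m @[m --> \oo] --> 0 by exact: cvg_harmonic.
apply: (@leb_int_gt0 _ _ _ 0 1) => //.
(* The limit integrand is measurable as a pointwise limit along an auxiliary sequence of scales. *)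
- apply: (@emeasurable_fun_cvg _ _ _ _
    (fun m x => (scaled_weight alpha H ths k (s m) x)%:E)).
    by move=> m; apply/measurable_EFinP; exact: measurable_scaled_weight.
  move=> x _; apply: cvg_EFin; first exact: nearW.
  exact: scaled_weight_cvg.
- by move=> x; rewrite lee_fin limit_weight_ge0.
- by move=> x hx; rewrite lte_fin limit_weight_gt0// => j; case/andP: (hx j).
Qed.

(** All rescaled integrals are below the integral [Mj] of the majorant, and the bound passes to
    their limit. *)
Lemma leb_int_limit_weight_lty : (leb_int (fun x => (limit_weight x)%:E) < +oo)%E.
Proof.
pose s (m : nat) : R := m.+1%:R^-1.
have s0 m : 0 < s m by rewrite invr_gt0.
have sc : s m @[m --> \oo] --> 0 by exact: cvg_harmonic.
pose Mj := leb_int (fun x : N.-tuple R => (majorant_cst alpha ths k *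
     \prod_(j < N) majorant_coord alpha ths c k j (tnth x j))%:E).
apply: (@le_lt_trans _ _ Mj); last first.
  apply: leb_int_prod_lty.
  - by move=> j; exact: measurable_majorant_coord.
  - by move=> j y; exact: majorant_coord_ge0.
  - by move=> j; exact: majorant_coord_lty.
  - exact: majorant_cst_ge0.
have H1 := leb_int_scaled_weight_cvg s0 sc.
rewrite -(cvg_lim _ H1)//; apply: lime_le.
  by apply/cvg_ex; eexists; exact: H1.
apply: nearW => m; apply: le_leb_int.
- by apply/measurable_EFinP; exact: measurable_scaled_weight.
- by apply: measurable_prod_tnth => j; exact: measurable_majorant_coord.
- by move=> x; rewrite lee_fin scaled_weight_ge0.
- by move=> x; rewrite lee_fin scaled_weight_le.
Qed.

End Limit.

(** * Counting exponents and removing the far region *)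

Section Assembly.
Context {R : realType} (N : nat).
Notation K := N.+1.
Variables (alpha : 'I_K -> R) (H : 'rV[R]_K -> R) (ths : 'rV[R]_K) (k : 'I_K) (c : R).
Hypothesis sths : simplex ths.
Hypothesis kZ : k \notin zero_idx ths.
Hypothesis alpha0 : forall i, 0 < alpha i.
Hypothesis Hc : {within @simplex R K, continuous H}.
Hypothesis c0 : 0 < c.
Hypothesis Hgap : forall v, simplex v -> H v - H ths <= - (c * gap ths v).

Notation Z := (zero_idx ths).
Notation W := (weight alpha H (H ths)).

Definition rate (n : R) : R := n `^ (- ((K%:R - 1 - #|Z|%:R) / 2))
   * n `^ (- \sum_(i in Z) alpha i).

Lemma prod_powR (I : Type) (r : seq I) (n : R) (e : I -> R) : 0 < n ->
  \prod_(i <- r) n `^ e i = n `^ (\sum_(i <- r) e i).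
Proof.
move=> n0; elim: r => [|i r IH]; first by rewrite !big_nil powRr0.
by rewrite !big_cons IH powRD ?(gt_eqF n0) ?implybT//.
Qed.

Lemma rateE n : 0 < n ->
  rate n = \prod_(j < N) n `^ (if free_idx k j \in Z then - alpha (free_idx k j) else - 2^-1).
Proof.
move=> n0; rewrite /rate prod_powR// -powRD ?(gt_eqF n0) ?implybT//; congr (_ `^ _).
(* The exponents are first summed over all [K] indices; removing [k], which lies outside Z and
   contributes [- 1/2], gives the sum over the free ones. *)
have : \sum_(i < K) (if i \in Z then - alpha i else - 2^-1) =
    - \sum_(i in Z) alpha i - (K%:R - #|Z|%:R) / 2.
  transitivity (\sum_(i < K) ((if i \in Z then - alpha i else 0) +
      (- 2^-1 + (if i \in Z then 2^-1 else 0)))).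
    by apply: eq_bigr => i _; case: ifP => _; ring.
  rewrite !big_split/= -!big_mkcond/= sumrN !sumr_const card_ord.
  rewrite -(mulr_natl (- 2^-1)) -(mulr_natl 2^-1); ring.
rewrite (big_free_idx _ k)/= (negbTE kZ) => E.
have -> : \sum_(j < N) (if free_idx k j \in Z then - alpha (free_idx k j) else - 2^-1) =
   - \sum_(i in Z) alpha i - (K%:R - #|Z|%:R) / 2 + 2^-1 by rewrite -E; ring.
by field.
Qed.

(** Here [s ^+ 2 = n^-1]. For an index in Z the Jacobian [n^-1] is [n^-alpha] times [n^(alpha - 1)],
    the second factor being the one stored in [scale_inv]. *)
Lemma scale_prod n : 0 < n -> let s := (Num.sqrt n)^-1 in
  \prod_(j < N) scale_fac ths s (free_idx k j) = rate n * scale_inv alpha ths k s.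
Proof.
move=> n0 s; rewrite rateE// /scale_inv -big_split/=; apply: eq_bigr => j _.
have s2 : s ^+ 2 = n^-1 by rewrite /s exprVn sqr_sqrtr// ltW.
rewrite /scale_fac; case: ifP => _; last first.
  by rewrite mulr1 powRN powR12_sqrt// ltW.
rewrite s2 -powR_inv1 ?(ltW n0)// -powRrM -powRD ?(gt_eqF n0) ?implybT//.
by congr (_ `^ _); ring.
Qed.

Lemma measurable_chart_weight (S : set 'rV[R]_K) n : closed S -> S `<=` simplex ->
  measurable_fun setT (fun t : N.-tuple R => (W S n (chart k t))%:E).
Proof.
move=> cS SS; apply/measurable_EFinP; apply: measurable_weight => // i.
exact: measurable_chart.
Qed.

(** An exact identity for each [n]: the rate is already complete, and only the integral on the right
    still varies. *)
Lemma leb_int_near n : 0 < n ->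
  leb_int (fun t : N.-tuple R => (W (near_simplex ths) n (chart k t))%:E) =
  ((rate n)%:E * leb_int (fun x => (scaled_weight alpha H ths k (Num.sqrt n)^-1 x)%:E))%E.
Proof.
move=> n0; set s := (Num.sqrt n)^-1.
have s0 : 0 < s by rewrite invr_gt0 sqrtr_gt0.
have sn : s ^- 2 = n by rewrite /s exprVn invrK sqr_sqrtr// ltW.
rewrite (leb_int_affine (fun j => ths 0 (free_idx k j)) (b := fun j => scale_fac ths s (free_idx k j))).
- rewrite scale_prod// EFinM -muleA; congr (_ * _)%E.
  rewrite -leb_intZl//; last 3 first.
  + apply/measurable_EFinP; apply: measurable_weight => //.
    * exact: measurable_scaled_pt.
    * exact: closed_near_simplex.
    * exact: near_simplex_sub.
  + by move=> t; rewrite lee_fin weight_ge0.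
  + exact: scale_inv_ge0.
  congr leb_int; apply/funext => x.
  by rewrite /scaled_weight sn EFinM.
- apply: measurable_chart_weight; first exact: closed_near_simplex.
  exact: near_simplex_sub.
- by move=> t; rewrite lee_fin weight_ge0.
- by move=> j; rewrite /scale_fac; case: ifP => _ //; rewrite exprn_gt0.
Qed.

(** One coordinate with [v_i < ths_i / 2] already contributes more than [(ths_i / 2) ^+ 2]; [rho] is
    the least of these values, capped at 1. *)
Lemma far_gap : exists2 rho, 0 < rho & forall v, simplex v -> ~ near_simplex ths v ->
  rho <= gap ths v.
Proof.
exists (\big[Num.min/1]_(i < K | i \notin Z) (ths 0 i / 2) ^+ 2).
  elim/big_ind : _ => // [a b a0 b0|i iZ]; first by rewrite lt_min a0.
  by rewrite exprn_gt0// divr_gt0// ths_gt0.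
move=> v sv nv; have [i iZ vi] : exists2 i, i \notin Z & v 0 i < ths 0 i / 2.
  apply: contrapT => h; apply: nv; split=> // i /= iZ; rewrite leNgt; apply/negP => vi.
  by apply: h; exists i.
apply: (@le_trans _ _ ((ths 0 i / 2) ^+ 2)); first exact: bigmin_le_cond.
apply: (@le_trans _ _ ((v 0 i - ths 0 i) ^+ 2)).
  have t0 := ths_gt0 sths iZ.
  rewrite -[leRHS]sqrrN ler_sqr ?nnegrE; first by lra.
    by rewrite divr_ge0// ltW.
  by lra.
rewrite /gap (bigD1 i (P := xpredT))//= addrCA lerDl addr_ge0//.
  by apply: sumr_ge0 => j _; case: sv.
by apply: sumr_ge0 => j _; exact: sqr_ge0.
Qed.

Definition far_weight (n : R) (v : 'rV[R]_K) : R :=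
  W simplex n v - W (near_simplex ths) n v.

Lemma far_weight_ge0 n v : 0 <= far_weight n v.
Proof.
rewrite /far_weight /weight; case: (asboolP (near_simplex ths v)) => [nv|_].
  by rewrite asboolT ?subrr//; exact: near_simplex_sub nv.
rewrite subr0; exact: weight_ge0.
Qed.

(** The exponential is bounded uniformly and the density is left intact, so its singularities are
    integrated by the Dirichlet normalisation. *)
Lemma far_weight_le rho n v : 0 <= n ->
  (forall v, simplex v -> ~ near_simplex ths v -> rho <= gap ths v) ->
  far_weight n v <= expR (- (n * (c * rho))) * W simplex 0 v.
Proof.
move=> n0 hrho; rewrite /far_weight /weight.
case: (asboolP (near_simplex ths v)) => [nv|nv].
  have sv := near_simplex_sub nv.
  rewrite asboolT// subrr mulr_ge0 ?expR_ge0// mulr_ge0 ?expR_ge0// prodr_ge0// => i _.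
  exact: powR_ge0.
rewrite subr0; case: asboolP => [sv|_]; last by rewrite mulr0.
rewrite mul0r expR0 mulr1 mulrC ler_wpM2r//.
  by apply: prodr_ge0 => i _; exact: powR_ge0.
rewrite ler_expR -mulrN ler_wpM2l// (le_trans (Hgap sv))// lerN2 ler_wpM2l ?(ltW c0)//.
exact: hrho.
Qed.

Lemma measurable_far_weight n :
  measurable_fun setT (fun t : N.-tuple R => (far_weight n (chart k t))%:E).
Proof.
apply/measurable_EFinP; apply: measurable_funB; apply/measurable_EFinP.
  by apply: measurable_chart_weight => //; exact: closed_simplex.
apply: measurable_chart_weight; first exact: closed_near_simplex.
exact: near_simplex_sub.
Qed.

Lemma leb_int_split n :
  leb_int (fun t : N.-tuple R => (W simplex n (@complete_pt R K t))%:E) =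
  (leb_int (fun t : N.-tuple R => (W (near_simplex ths) n (chart k t))%:E) +
   leb_int (fun t : N.-tuple R => (far_weight n (chart k t))%:E))%E.
Proof.
rewrite (leb_int_chart (F := fun v => (W simplex n v)%:E) k); last 2 first.
- under eq_fun do rewrite -chart_ord_max.
  apply/measurable_EFinP; apply: measurable_weight => //; last exact: closed_simplex.
  by move=> i; exact: measurable_chart.
- by move=> v; rewrite lee_fin weight_ge0.
rewrite -leb_intD.
- congr leb_int; apply/funext => t.
  by rewrite -EFinD /far_weight addrC subrK.
- apply: measurable_chart_weight; first exact: closed_near_simplex.
  exact: near_simplex_sub.
- exact: measurable_far_weight.
- by move=> t; rewrite lee_fin weight_ge0.
- by move=> t; rewrite lee_fin far_weight_ge0.
Qed.

Lemma leb_int_far_le : exists2 d, 0 < d & forall n, 0 <= n ->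
  (leb_int (fun t : N.-tuple R => (far_weight n (chart k t))%:E) <=
   (expR (- (d * n)))%:E *
   leb_int (fun t : N.-tuple R => (W simplex 0 (@complete_pt R K t))%:E))%E.
Proof.
have [rho rho0 hrho] := far_gap.
exists (c * rho) => [|n n0]; first by rewrite mulr_gt0.
rewrite (leb_int_chart (F := fun v => (W simplex 0 v)%:E) k); last 2 first.
- under eq_fun do rewrite -chart_ord_max.
  apply/measurable_EFinP; apply: measurable_weight => //; last exact: closed_simplex.
  by move=> i; exact: measurable_chart.
- by move=> v; rewrite lee_fin weight_ge0.
have mW : measurable_fun setT (fun t : N.-tuple R => (W simplex 0 (chart k t))%:E).
  by apply: measurable_chart_weight => //; exact: closed_simplex.
rewrite -leb_intZl ?expR_ge0//; last by move=> t; rewrite lee_fin weight_ge0.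
apply: le_leb_int.
- exact: measurable_far_weight.
- exact: measurable_funeM.
- by move=> t; rewrite lee_fin far_weight_ge0.
- move=> t; rewrite -EFinM lee_fin mulrC [_ * n]mulrC mulrC; exact: far_weight_le.
Qed.

Lemma rate_gt0 n : 0 < n -> 0 < rate n.
Proof. by move=> n0; rewrite mulr_gt0 ?powR_gt0. Qed.

Lemma rate_powR n : 0 < n ->
  (rate n)^-1 = n `^ ((K%:R - 1 - #|Z|%:R) / 2 + \sum_(i in Z) alpha i).
Proof.
by move=> n0; rewrite /rate !powRN -invfM invrK powRD ?(gt_eqF n0) ?implybT//.
Qed.

(** At most [K - 1] indices lie in Z, since [k] does not. It makes [p + 1] positive in the estimate
    of the far region. *)
Lemma rate_exponent_ge0 :
  0 <= (K%:R - 1 - #|Z|%:R) / 2 + \sum_(i in Z) alpha i.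
Proof.
rewrite addr_ge0//; last by apply: sumr_ge0 => i _; exact: ltW.
rewrite divr_ge0// -natr1 addrK subr_ge0 ler_nat.
have : (#|Z| <= #|[set~ k]%SET|)%N.
  apply: subset_leq_card; apply/fintype.subsetP => i iZ.
  by rewrite finset.in_setC1; apply: contraNneq kZ => <-.
by rewrite cardsC1 card_ord.
Qed.

End Assembly.

Lemma cvg_sqrt_inv {R : realType} (u : nat -> R) : u m @[m --> \oo] --> +oo ->
  (Num.sqrt (Num.max (u m) 1))^-1 @[m --> \oo] --> (0 : R).
Proof.
move=> /cvgryPge uy; apply/cvgrPdistC_le => e e0.
apply: filterS (uy (e^-1 ^+ 2)) => m um; rewrite subr0.
have m0 : 0 < Num.max (u m) 1 by rewrite lt_max ltr01 orbT.
rewrite ger0_norm ?invr_ge0 ?sqrtr_ge0// -[leRHS]invrK lef_pV2 ?posrE ?invr_gt0 ?sqrtr_gt0//.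
have eV0 : 0 <= e^-1 by rewrite invr_ge0 ltW.
by rewrite -(ger0_norm eV0) -sqrtr_sqr ler_wsqrtr// le_max um.
Qed.

Theorem theorem1 (R : realType) (K : nat) (alpha : 'I_K -> R)
    (H : 'rV[R]_K -> R) (ths : 'rV[R]_K) :
  (2 <= K)%N ->
  (forall i, 0 < alpha i) ->
  (* (A1) *)
  simplex ths ->
  (forall th, simplex th -> th != ths -> H th < H ths) ->
  (* (A2) *)
  {within @simplex R K, continuous H} ->
  (exists U : set 'rV[R]_K, U ths /\ C2_on U H) ->
  (* (A3): KKT multipliers, with lambda_i > 0 on Z *)
  (exists (lam : 'I_K -> R) (mu : R),
      gradient H ths =
        - (\sum_(i in zero_idx ths) lam i *: basis_vec i)
        + mu *: const_mx 1
      /\ (forall i, ths 0 i = 0 -> 0 < lam i)) ->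
  (* (A4) *)
  (forall d : 'rV[R]_K, d != 0 -> \sum_(i < K) d 0 i = 0 ->
      (forall i, ths 0 i = 0 -> d 0 i = 0) ->
      (d *m hessian H ths *m d^T) 0 0 < 0) ->
  exists C : R, 0 < C /\
    ((fun n : R =>
        (dir_expect alpha (fun th => expR (n * H th))
         * ((C * expR (n * H ths)
             * n `^ (- ((K%:R - 1 - #|zero_idx ths|%:R) / 2))
             * n `^ (- \sum_(i in zero_idx ths) alpha i))^-1)%:E)%E)
     @ +oo --> (1%:E : \bar R)).
Proof.
case: K alpha H ths => [//|N] alpha H ths _ alpha0 sths Hmax Hc [U [Uths HU]].
move=> [lam [mu [kkt lam0]]] Hneg.
have [c c0 Hgap] := quadratic_bound sths Hmax Hc HU Uths kkt lam0 Hneg.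
have [k kZ] : exists k, k \notin zero_idx ths.
  apply: contrapT => /forallNP hk; have [_] := sths; apply/eqP.
  rewrite big1 => [|i _]; first by rewrite eq_sym oner_eq0.
  by have := hk i; rewrite inE => /negP; rewrite negbK => /eqP.
pose W := weight alpha H (H ths).
pose BE := leb_int (fun t : N.-tuple R => (W simplex 0 (@complete_pt R N.+1 t))%:E).
have BE0 : (0 < BE)%E by exact: weight_norm_gt0.
have BEy : (BE < +oo)%E by exact: weight_norm_lty.
have BEfin : BE \is a fin_num by rewrite ge0_fin_numE// ltW.
pose B := fine BE.
have B0 : 0 < B by rewrite fine_gt0// BE0.
pose LE := leb_int (fun x : N.-tuple R => (limit_weight alpha H ths k lam x)%:E).
have LE0 : (0 < LE)%E by exact: (leb_int_limit_weight_gt0 alpha sths kZ HU Uths kkt Hc).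
have LEy : (LE < +oo)%E.
  exact: (leb_int_limit_weight_lty sths kZ HU Uths kkt alpha0 Hc c0 Hgap).
have LEfin : LE \is a fin_num by rewrite ge0_fin_numE// ltW.
pose L := fine LE.
have L0 : 0 < L by rewrite fine_gt0// LE0.
exists (L / B); split; first exact: divr_gt0.
have normE : dir_norm alpha = BE.
  rewrite /dir_norm /BE; congr leb_int; apply/funext => t.
  by rewrite /dir_kernel /W /weight; case: ifP => // _; rewrite mul0r expR0 mulr1.
pose J n := leb_int (fun t : N.-tuple R => (W simplex n (@complete_pt R N.+1 t))%:E).
have expectE n : dir_expect alpha (fun th => expR (n * H th)) =
    ((expR (n * H ths))%:E * J n * (B^-1)%:E)%E.
  rewrite /dir_expect normE -/B; congr (_ * _)%E.
  rewrite -leb_intZl ?expR_ge0//; last 2 first.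
  - apply/measurable_EFinP; apply: measurable_weight => //; last exact: closed_simplex.
    exact: measurable_complete_pt.
  - by move=> t; rewrite lee_fin weight_ge0.
  congr leb_int; apply/funext => t; rewrite -EFinM /dir_kernel /W /weight.
  case: ifP => _; last by rewrite mul0r mulr0.
  by rewrite mulrCA -expRD mulrBr addrC subrK.
have [d d0 hfar] := leb_int_far_le alpha k sths Hc c0 Hgap.
pose near_int s := leb_int (fun x => (scaled_weight alpha H ths k s x)%:E).
pose far_int n := leb_int (fun t : N.-tuple R => (far_weight alpha H ths n (chart k t))%:E).
have near_fin s : 0 < s -> near_int s \is a fin_num.
  move=> s0; rewrite ge0_fin_numE.
    exact: (leb_int_scaled_weight_lty sths kZ alpha0 Hc c0 Hgap).
  by apply: leb_int_ge0 => x; rewrite lee_fin scaled_weight_ge0.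
have far_ge0 n : (0 <= far_int n)%E.
  by apply: leb_int_ge0 => t; rewrite lee_fin far_weight_ge0.
have far_fin n : 0 <= n -> far_int n \is a fin_num.
  move=> n0; rewrite ge0_fin_numE//; apply: le_lt_trans (hfar _ n0) _.
  by rewrite -/BE -(fineK BEfin) -EFinM ltry.
have JE n : 0 < n -> J n = ((rate alpha ths n)%:E * near_int ((Num.sqrt n)^-1)%R + far_int n)%E.
  by move=> n0; rewrite /J (leb_int_split alpha ths k Hc) (leb_int_near _ kZ Hc n0).
pose p := ((N.+1)%:R - 1 - #|zero_idx ths|%:R) / 2 + \sum_(i in zero_idx ths) alpha i.
have p1 : 0 < p + 1 by rewrite ltr_wpDl// (rate_exponent_ge0 kZ alpha0).
(* The far integral over the rate is at most [B n^p expR (- d n)]. Estimating [n^(p+1) expR (- d n)]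
   instead leaves a spare factor [1/n], which tends to 0. *)
pose M := ((p + 1) / d) `^ (p + 1) * B.
have far_le n : 0 < n -> fine (far_int n) / rate alpha ths n <= M / n.
  move=> n0; have n0' := ltW n0.
  have h1 : fine (far_int n) <= expR (- (d * n)) * B.
    by rewrite -lee_fin fineK ?far_fin// EFinM fineK//; exact: hfar.
  rewrite rate_powR// -/p ler_pdivlMr// -mulrA -[X in _ * (_ * X)]powRr1//.
  rewrite -powRD ?(gt_eqF n0) ?implybT//.
  apply: (le_trans (ler_wpM2r (powR_ge0 _ _) h1)).
  rewrite mulrAC ler_wpM2r ?(ltW B0)// mulrC; exact: expR_powR_bound.
(* Dominated convergence is sequential, so the limit at infinity is tested along sequences. Taking
   the maximum with 1 makes every scale positive and changes only finitely many terms. *)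
apply/cvge_pinftyP => u uy.
pose n m := Num.max (u m) 1.
have n1 m : 1 <= n m by rewrite le_max lexx orbT.
have n0 m : 0 < n m by exact: lt_le_trans (n1 m).
pose s m := (Num.sqrt (n m))^-1.
have s0 m : 0 < s m by rewrite invr_gt0 sqrtr_gt0.
have sc : s m @[m --> \oo] --> 0 by exact: cvg_sqrt_inv.
have Ac : fine (near_int (s m)) @[m --> \oo] --> L.
  apply: fine_cvg; rewrite fineK//.
  exact: (leb_int_scaled_weight_cvg sths kZ HU Uths kkt alpha0 Hc c0 Hgap s0 sc).
have Ec : fine (far_int (n m)) / rate alpha ths (n m) @[m --> \oo] --> 0.
  apply: (@squeeze_cvgr _ _ _ _ (cst 0) (fun m => M * (s m * s m))).
  - apply: nearW => m; rewrite divr_ge0 ?fine_ge0 ?(ltW (rate_gt0 _ _ (n0 m)))//=.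
    rewrite -expr2 /s exprVn sqr_sqrtr ?(ltW (n0 m))//; exact: far_le.
  - exact: cvg_cst.
  - have := cvgM (cvg_cst M) (cvgM sc sc); rewrite !mulr0; exact.
(* This is the ratio of the theorem once [expR (n * H ths)], [B] and the rate have cancelled. *)
have fc : fine (near_int (s m)) / L + fine (far_int (n m)) / rate alpha ths (n m) / L
    @[m --> \oo] --> (1 : R).
  have := cvgD (cvgM Ac (cvg_cst L^-1)) (cvgM Ec (cvg_cst L^-1)).
  by rewrite divff ?gt_eqF// mul0r addr0; exact.
have fcE : (fine (near_int (s m)) / L +
    fine (far_int (n m)) / rate alpha ths (n m) / L)%:E @[m --> \oo] --> (1%:E : \bar R).
  by apply: cvg_EFin => //; exact: nearW.
apply: cvg_trans fcE; apply: near_eq_cvg.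
have /cvgryPge/(_ 1) := uy; apply: filterS => m um.
have nu : n m = u m by rewrite /n max_l.
rewrite -nu expectE JE// -/(s m).
have [a ->] : exists a, near_int (s m) = a%:E.
  by exists (fine (near_int (s m))); rewrite fineK// near_fin.
have [b ->] : exists b, far_int (n m) = b%:E.
  by exists (fine (far_int (n m))); rewrite fineK// far_fin// ltW.
rewrite /= -!EFinM; congr (_%:E).
rewrite -[X in _ = _ / X]mulrA -/(rate alpha ths (n m)).
have r0 := rate_gt0 alpha ths (n0 m).
have e0 := expR_gt0 (n m * H ths).
by field; rewrite !gt_eqF.
Qed.
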